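(* Let $0<\beta<1$ and $q=1/(1-\beta)$. If $f\in W^{1,1}(\mathbb{R})$, then $M_\beta f$ is differentiable almost everywhere and $$\|(M_\beta f)'\|_{L^q(\mathbb{R})}\le C\,\|f'\|_{L^1(\mathbb{R})},\qquad\text{where } C=2^{-3\beta-2+\frac{4}{\beta}}\,3^{\frac{2(1-\beta)^2}{\beta}}.$$ Moreover, the map $f\mapsto |(M_\beta f)'|$ is continuous from $W^{1,1}(\mathbb{R})$ to $L^q(\mathbb{R})$.
   Context: $M_\beta$ is the centered fractional maximal operator on $\mathbb{R}$: for $f\in L^1_{loc}(\mathbb{R})$ and $x\in\mathbb{R}$, $$M_\beta f(x)=\sup_{r\ge 0}\frac{r^\beta}{|B(x,r)|}\int_{B(x,r)}|f(y)|\,dy,$$ where $B(x,r)=(x-r,x+r)$, $|\cdot|$ of a set denotes Lebesgue measure, and $r=0$ is understood as a limiting case (contributing $0$ since $\beta>0$). $f'$ is the weak derivative of $f$, and $(M_\beta f)'$ is the almost everywhere defined derivative of $M_\beta f$. *)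

(* Defs.v *)
From HB Require Import structures.
From mathcomp Require Export all_boot all_order all_algebra.
From mathcomp Require Export all_classical all_reals all_analysis.
Export Order.TTheory GRing.Theory Num.Theory.
Export numFieldNormedType.Exports.
Set Implicit Arguments.
Unset Strict Implicit.
Unset Printing Implicit Defensive.

Local Open Scope classical_set_scope.
Local Open Scope ring_scope.

Section defs.
Context {R : realType}.
Implicit Types f df phi : R -> R.

Local Notation mu := (@lebesgue_measure R).

Definition test_function phi :=
  (forall n x, derivable (derive1n n phi) x 1) /\
  compact (closure [set x | phi x != 0]).

Definition weak_derivative f df :=
  [/\ locally_integrable setT f, locally_integrable setT df &
      forall phi, test_function phi ->
        (\int[mu]_x (f x * derive1 phi x)%:E = - \int[mu]_x (df x * phi x)%:E)%E].

(* The weak derivative is carried along, since it is only determined up to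
   equality almost everywhere. *)
Definition W11 f df :=
  [/\ f \in Lfun mu 1%E, df \in Lfun mu 1%E & weak_derivative f df].

Definition W11_norm f df : \bar R :=
  ('N[mu]_1[EFin \o f] + 'N[mu]_1[EFin \o df])%E.

(* At r = 0 the ball is empty and iavg is 0, so that radius contributes 0. *)
Definition frac_maximal (beta : R) f (x : R) : \bar R :=
  ereal_sup [set ((r `^ beta)%:E * iavg f (ball x r))%E
            | r in `[0, +oo[%classic].

(* fine sends infinite values to 0, hence the finiteness requirement. *)
Definition ediff_at (F : R -> \bar R) (x : R) :=
  (\forall y \near x, F y \is a fin_num) /\ derivable (fine \o F) x 1.

(* 0 by convention where the derivative does not exist. *)
Definition frac_maximal_deriv (beta : R) f : R -> R :=
  derive1 (fine \o frac_maximal beta f).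

End defs.

(* Main.v *)
(** A maximizing radius [r] at [x] satisfies [|f|(x+r) + |f|(x-r) = 2(1-beta) a],
    where [a] is the average of [|f|] on [B(x,r)]. Hence
    [|(M_beta f)'(x)| <= (1-beta) r^(beta-1) a], and [|f|], which equals [a]
    somewhere in the ball, has variation at least [beta a] on the part of the ball
    where [(1-beta) a < |f| < a]. If these parts share a point for two centers, then
    the two radii are comparable, so Tonelli's theorem turns these pointwise bounds
    into the [L^q] bound. As long as all maximizing radii at [x] give the same
    slope, [M_beta f] is differentiable at [x] and its derivative is stable under
    perturbation of [f]; this fails for countably many [x] only. Continuity follows
    by dominated convergence on bounded intervals, the tails being uniformly small
    by the same Tonelli argument. *)

Require Import Defs.
From mathcomp Require Import all_boot all_order all_algebra.
From mathcomp Require Import all_classical all_reals all_analysis.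
From mathcomp Require Import measurable_realfun ring lra.
Set Implicit Arguments.
Unset Strict Implicit.
Unset Printing Implicit Defensive.
Local Open Scope classical_set_scope.
Local Open Scope ring_scope.

(** * Maximizing radii *)

(** The exponent [q] is the one with [(beta - 1) * q = - 1]. The [q]-th power of the slope bound
    therefore carries the factor [1 / r], while the centers that share a given point with radii
    comparable to [r] fill a set of length comparable to [r]: the integral over centers is
    independent of the scale. Of the factor [a ^ q], one [a] is paid for by the variation on the
    level set, and [a ^ (q - 1)] by the bound of [|f|] by half the norm of [f'].

    The operator is not linear, so the norm bound gives continuity only at [f = 0], which is exactly
    the case excluded from [admissible]. Elsewhere the obstacle is that maximizing radii are neither
    unique nor continuous in [x] or [f]. What survives is semicontinuity: a maximizing radius of a
    nearby problem is close to some maximizing radius of the original one. Differentiability,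
    measurability and pointwise convergence all rest on this.

    In the constant, the power of 3 comes from the tripled ball and is matched exactly; the
    remaining factors are compared with room to spare. *)

Section maximizers.
Context {R : realType} (beta : R).
Hypotheses (beta_gt0 : 0 < beta) (beta_lt1 : beta < 1).
Implicit Types (u Phi : R -> R) (x r s : R).

(** [u] is the absolute value of the continuous representative of a Sobolev
    function and [Phi] a primitive of [u]; [adm_neq0] excludes [u = 0], for
    which every radius is maximizing. *)
Record admissible u Phi : Prop := Admissible {
  adm_derive : forall x, is_derive x 1 Phi (u x);
  adm_cont : continuous u;
  adm_ge0 : forall x, 0 <= u x;
  adm_bound : exists M, forall x, u x <= M;
  adm_mass : exists m, forall x, 0 <= Phi x <= m;
  adm_neq0 : exists a b, Phi a < Phi b }.

(** If [Phi' = u], this is [r ^ beta] times the average of [u] on [B(x, r)], and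
    [wdiff u x r] is its derivative in [x]. *)
Definition wdiff Phi x r := r `^ (beta - 1) / 2 * (Phi (x + r) - Phi (x - r)).

Definition maximizer Phi x r :=
  0 < r /\ forall s, 0 < s -> wdiff Phi x s <= wdiff Phi x r.

Definition close_by (e : R) u Phi u' Phi' :=
  forall t, `|u t - u' t| <= e /\ `|Phi t - Phi' t| <= e.

Lemma adm_continuous u Phi : admissible u Phi -> continuous Phi.
Proof.
by move=> A x; apply/differentiable_continuous/derivable1_diffP; have [] := adm_derive A x.
Qed.

Lemma adm_MVT u Phi a b : admissible u Phi -> a < b ->
  exists2 c, a < c < b & Phi b - Phi a = u c * (b - a).
Proof.
move=> A ab.
have [c] := MVT ab (fun x _ => adm_derive A x)
  (continuous_subspaceT (adm_continuous A)).
by rewrite in_itv /= => cab E; exists c.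
Qed.

Lemma adm_ndecr u Phi a b : admissible u Phi -> a <= b -> Phi a <= Phi b.
Proof.
move=> A; rewrite le_eqVlt => /predU1P[->//|ab].
have [c _ E] := adm_MVT A ab.
by rewrite -subr_ge0 E mulr_ge0// ?adm_ge0 ?(adm_ge0 A)// subr_ge0 ltW.
Qed.

Lemma wdiff_ge0 u Phi x r : admissible u Phi -> 0 < r -> 0 <= wdiff Phi x r.
Proof.
move=> A r0; apply: mulr_ge0; first by rewrite divr_ge0// powR_ge0.
by rewrite subr_ge0; apply: adm_ndecr A _; lra.
Qed.

Lemma powR_B1 r : 0 < r -> r * r `^ (beta - 1) = r `^ beta.
Proof. by move=> r0; rewrite mulr_powRB1// ltW. Qed.

Lemma wdiff_mean u Phi x r : admissible u Phi -> 0 < r ->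
  exists2 c, `|x - c| < r & wdiff Phi x r = r `^ beta * u c.
Proof.
move=> A r0; have [|c /andP[c1 c2] E] := @adm_MVT u Phi (x - r) (x + r) A.
  lra.
exists c; first by rewrite ltr_norml; lra.
by rewrite /wdiff E -(powR_B1 r0); field.
Qed.

Lemma wdiff_le_bound u Phi M x r : admissible u Phi -> 0 < r ->
  (forall x, u x <= M) -> wdiff Phi x r <= r `^ beta * M.
Proof.
move=> A r0 uM; have [c _ ->] := wdiff_mean x A r0.
by rewrite ler_wpM2l ?powR_ge0.
Qed.

Lemma powR_lt_root (p a r : R) : 0 < p -> 0 <= a -> 0 <= r ->
  r < a `^ p^-1 -> r `^ p < a.
Proof.
move=> p0 a0 r0 ra; rewrite -[ltRHS](powRr1 a0) -(mulVf (lt0r_neq0 p0)) powRrM.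
by rewrite gt0_ltr_powR// nnegrE// powR_ge0.
Qed.

Lemma powR_gt_root (p a r : R) : 0 < p -> 0 <= a ->
  a `^ p^-1 < r -> a < r `^ p.
Proof.
move=> p0 a0 ra; rewrite -[ltLHS](powRr1 a0) -(mulVf (lt0r_neq0 p0)) powRrM.
by rewrite gt0_ltr_powR// nnegrE ?powR_ge0// (le_trans _ (ltW ra))// powR_ge0.
Qed.

(** Small radii lose because [u] is bounded, large ones because [Phi] is; the
    bounds are uniform in a neighborhood of [(u, Phi)]. *)
Lemma wdiff_concentrated u Phi (A : R) : admissible u Phi -> 0 <= A ->
  exists r0 R0 e s0 : R, [/\ 0 < r0, 0 < e, 0 < s0, r0 <= s0 & s0 <= R0] /\
    (forall u' Phi' x r, admissible u' Phi' -> close_by e u Phi u' Phi' ->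
      `|x| <= A -> 0 < r -> (r < r0) || (R0 < r) ->
      wdiff Phi' x r < wdiff Phi' x s0).
Proof.
move=> aP A0.
have [a [b ab]] := adm_neq0 aP; have [M uM] := adm_bound aP.
have [m Pm] := adm_mass aP.
have M0 : 0 <= M by rewrite (le_trans _ (uM 0))// (adm_ge0 aP).
have m0 : 0 <= m by have /andP[/le_trans h /h] := Pm 0.
(* For every center with [|x| <= A] the ball of radius [s0] contains [a] and [b], hence captures the
   increment of [Phi] between them. *)
pose s0 := A + `|a| + `|b| + 1.
have s0_gt0 : 0 < s0.
  by rewrite /s0 ltr_wpDl// !addr_ge0.
pose c := Phi b - Phi a; have c0 : 0 < c by rewrite subr_gt0.
(* Lower bound for [wdiff Phi' x s0]: replacing [Phi] by [Phi'] costs at most [c / 4] at each of [a]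
   and [b], which leaves [c / 2]. *)
pose k := s0 `^ (beta - 1) / 2 * (c / 2).
have k0 : 0 < k by rewrite !mulr_gt0// powR_gt0.
(* Up to the cut-off at [s0], the thresholds solve [r ^ beta * (M + 1) = k] and
   [r ^ (beta - 1) / 2 * (m + 2) = k]. As [e <= 1], [M + 1] bounds [u'] and [m + 2] bounds the
   increments of [Phi']. *)
pose r0 := Order.min s0 ((k / (M + 1)) `^ beta^-1).
pose R0 := Order.max s0 ((((m + 2) / (2 * k))) `^ (1 - beta)^-1).
pose e := Order.min 1 (c / 4).
have e0 : 0 < e by rewrite lt_min ltr01 divr_gt0.
have r00 : 0 < r0 by rewrite lt_min s0_gt0 powR_gt0// divr_gt0// ltr_wpDl.
exists r0, R0, e, s0; split.
  by split => //; rewrite ?ge_min ?le_max lexx.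
move=> u' Phi' x r aP' cl xA r_gt0 Hr.
have kle : k <= wdiff Phi' x s0.
  rewrite /k /wdiff ler_wpM2l ?divr_ge0 ?powR_ge0//.
  have ? : `|a| >= a /\ `|a| >= - a by rewrite !ler_norm -normrN ler_norm.
  have ? : `|b| >= b /\ `|b| >= - b by rewrite !ler_norm -normrN ler_norm.
  have ? : `|x| >= x /\ `|x| >= - x by rewrite !ler_norm -normrN ler_norm.
  have h1 : Phi' (x - s0) <= Phi' a by apply: adm_ndecr aP' _; rewrite /s0; lra.
  have h2 : Phi' b <= Phi' (x + s0) by apply: adm_ndecr aP' _; rewrite /s0; lra.
  have [_] := cl a; have [_] := cl b.
  rewrite /e !le_min => /andP[_ /ler_normlP[b1 b2]] /andP[_ /ler_normlP[a1 a2]].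
  rewrite /c in b1 b2 a1 a2 *; lra.
apply: lt_le_trans kle.
have M1 : 0 < M + 1 by lra.
case/orP: Hr => Hr.
  have uM' t : u' t <= M + 1.
    have [+ _] := cl t; rewrite /e le_min => /andP[/ler_normlP[t1 t2] _].
    have := uM t; lra.
  apply: (le_lt_trans (wdiff_le_bound _ aP' r_gt0 uM')).
  rewrite -ltr_pdivlMr//; apply: powR_lt_root => //.
  - by rewrite divr_ge0// ltW.
  - exact: ltW.
  - by rewrite (lt_le_trans Hr)// ge_min lexx orbT.
rewrite /wdiff (@le_lt_trans _ _ (r `^ (beta - 1) / 2 * (m + 2)))//.
  rewrite ler_wpM2l ?divr_ge0 ?powR_ge0//.
  have [_] := cl (x + r); have [_] := cl (x - r).
  rewrite /e !le_min => /andP[/ler_normlP[b1 b2] _] /andP[/ler_normlP[a1 a2] _].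
  have /andP[_ +] := Pm (x + r); have /andP[+ _] := Pm (x - r); lra.
have b1 : 0 < 1 - beta by rewrite subr_gt0.
rewrite (_ : beta - 1 = - (1 - beta)); last by rewrite opprB.
rewrite powRN.
have : (m + 2) / (2 * k) < r `^ (1 - beta).
  apply: powR_gt_root => //.
    by apply: divr_ge0; [exact: addr_ge0|apply: mulr_ge0 => //; exact: ltW].
  by rewrite (le_lt_trans _ Hr)// le_max lexx orbT.
have rb0 : 0 < r `^ (1 - beta) by rewrite powR_gt0.
rewrite ltr_pdivrMr; last by rewrite mulr_gt0.
move=> h; rewrite (_ : _ * _ = (m + 2) / (2 * r `^ (1 - beta))); last first.
  by field; rewrite gt_eqF.
by rewrite ltr_pdivrMr ?mulr_gt0// mulrCA [k * _]mulrC mulrCA.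
Qed.

Lemma wdiff_continuous Phi x r : continuous Phi -> 0 < r ->
  {for (x, r), continuous (fun z : R * R => wdiff Phi z.1 z.2)}.
Proof.
move=> cP r0.
have c1 : {for r, continuous (fun t : R => t `^ (beta - 1))}.
  apply: differentiable_continuous; apply/derivable1_diffP.
  by have [] := @is_derive1_powR _ (beta - 1) r r0.
have c2 : {for (x, r), continuous (fun z : R * R => z.2 `^ (beta - 1))}.
  by apply: (@continuous_comp _ _ _ snd (fun t : R => t `^ (beta - 1)) (x, r)); [exact: cvg_snd|exact: c1].
have c3 : {for (x, r), continuous (fun z : R * R => Phi (z.1 + z.2))}.
  apply: (@continuous_comp _ _ _ (fun z : R * R => z.1 + z.2) Phi (x, r)); last exact: cP.
  by apply: cvgD; [exact: cvg_fst|exact: cvg_snd].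
have c4 : {for (x, r), continuous (fun z : R * R => Phi (z.1 - z.2))}.
  apply: (@continuous_comp _ _ _ (fun z : R * R => z.1 - z.2) Phi (x, r)); last exact: cP.
  by apply: cvgB; [exact: cvg_fst|exact: cvg_snd].
apply: cvgM; last exact: cvgB c3 c4.
by apply: cvgM; [exact: c2|exact: cvg_cst].
Qed.

End maximizers.

(** * Existence of maximizing radii and their stability under perturbation *)

Section nearby_maximizers.
Context {R : realType} (beta : R).
Hypotheses (beta_gt0 : 0 < beta) (beta_lt1 : beta < 1).
Implicit Types (u Phi : R -> R) (x r s e : R).
Local Notation G := (wdiff beta).
Local Notation maxr := (maximizer beta).

Lemma wdiff_continuity_modulus Phi x r d : continuous Phi -> 0 < r -> 0 < d ->
  exists2 d1, 0 < d1 & forall x' r', `|x - x'| < d1 -> `|r - r'| < d1 ->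
    `|G Phi x r - G Phi x' r'| < d.
Proof.
move=> cP r0 d0.
have /cvgrPdist_lt/(_ _ d0)/nbhs_ballP[d1 /= d10 B] := @wdiff_continuous _ beta _ x _ cP r0.
by exists d1 => // x' r' xd rd; exact: (B (x', r')).
Qed.

Lemma wdiff_continuous1 Phi x r : continuous Phi -> 0 < r ->
  {for r, continuous (G Phi x)}.
Proof.
move=> cP r0; apply/cvgrPdist_lt => d d0.
have [d1 d10 B] := wdiff_continuity_modulus x cP r0 d0.
near=> t; apply: B; first by rewrite subrr normr0.
suff : ball r d1 t by [].
by near: t; exact: (nbhsx_ballx r d1 d10).
Unshelve. all: by end_near. Qed.

Lemma close_refl e u Phi : 0 <= e -> close_by e u Phi u Phi.
Proof. by move=> e0 t; rewrite !subrr normr0. Qed.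

Lemma wdiff_close e Phi Phi' x r : (forall t, `|Phi t - Phi' t| <= e) ->
  `|G Phi x r - G Phi' x r| <= r `^ (beta - 1) * e.
Proof.
move=> cl; rewrite /wdiff -mulrBr normrM ger0_norm ?divr_ge0 ?powR_ge0//.
rewrite -mulrA ler_wpM2l ?powR_ge0//.
have /ler_normlP[a1 a2] := cl (x + r).
have /ler_normlP[b1 b2] := cl (x - r).
rewrite mulrC ler_pdivrMr//; apply/ler_normlP; split; lra.
Qed.

(** A maximum over the compact interval [[r0, R0]] is global, because the interval contains [s0],
    whose value exceeds every value outside. *)
Lemma exists_maximizer u Phi x : admissible u Phi -> exists r, maxr Phi x r.
Proof.
move=> aP.
have [r0 [R0 [e [s0 [[r00 e0 s00 rs sR] H]]]]] :=
  wdiff_concentrated beta_gt0 beta_lt1 aP (normr_ge0 x).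
have {}H r : 0 < r -> (r < r0) || (R0 < r) -> G Phi x r < G Phi x s0.
  by apply: (H u) => //; apply/close_refl/ltW.
have [|c cI cM] := @EVT_max _ (G Phi x) r0 R0 (le_trans rs sR).
  apply: continuous_in_subspaceT => r; rewrite inE/= in_itv/= => /andP[r0r _].
  have rp : 0 < r by exact: lt_le_trans r0r.
  exact: wdiff_continuous1 (adm_continuous aP) rp.
move: cI; rewrite in_itv/= => /andP[r0c cR].
exists c; split; first exact: lt_le_trans r0c.
move=> s s_gt0.
have [sI|] := boolP ((r0 <= s) && (s <= R0)); first by apply: cM; rewrite in_itv.
rewrite negb_and -!ltNge => /(H s s_gt0)/ltW/le_trans; apply; apply: cM.
by rewrite in_itv/= rs sR.
Qed.

(** Upper semicontinuity of the set of maximizing radii, jointly in the center and the function. A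
    radius that does not maximize at [x] is beaten by a definite amount, which survives small
    perturbations; compactness of [[r0, R0]] makes the size of the perturbation uniform. [W] may
    depend on [e], so that closeness of the data can enter the property. *)
Lemma maximizer_near u Phi x (W : R -> R -> Prop) : admissible u Phi ->
  (forall r, maxr Phi x r -> \forall r' \near r & e \near 0^'+, W e r') ->
  \forall e \near 0^'+, forall u' Phi' x' r', admissible u' Phi' ->
    close_by e u Phi u' Phi' -> `|x' - x| <= e -> maxr Phi' x' r' -> W e r'.
Proof.
move=> aP HW.
have x1 : 0 <= `|x| + 1 by rewrite addr_ge0.
have [r0 [R0 [e0 [s0 [[r00 e00 s00 rs sR] H]]]]] :=
  wdiff_concentrated beta_gt0 beta_lt1 aP x1.
pose P (e r' : R) := forall u' Phi' x', admissible u' Phi' ->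
    close_by e u Phi u' Phi' -> `|x' - x| <= e -> maxr Phi' x' r' -> W e r'.
have cK : compact `[r0, R0] by exact: segment_compact.
have main : forall r, [set` `[r0, R0]] r -> \forall r' \near r & e \near 0^'+, P e r'.
  move=> r; rewrite /= in_itv/= => /andP[r0r rR0].
  have r_gt0 : 0 < r by exact: lt_le_trans r0r.
  have [mr|nmr] := pselect (maxr Phi x r).
    by apply: filterS (HW r mr) => -[r' e] /= We u' Phi' x'.
  have [s [s_gt0 rsx]] : exists s, 0 < s /\ G Phi x r < G Phi x s.
    apply: contrapT => ns; apply: nmr; split => // s s_gt0.
    by rewrite leNgt; apply/negP => h; apply: ns; exists s.
  (* A quarter of the gap: each of the two values is perturbed once by moving its argument and once
     by replacing [Phi] with [Phi']. *)
  pose d := (G Phi x s - G Phi x r) / 4.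
  have d0 : 0 < d by rewrite divr_gt0// subr_gt0.
  have [d1 d10 B1] := wdiff_continuity_modulus x (adm_continuous aP) r_gt0 d0.
  have [d2 d20 B2] := wdiff_continuity_modulus x (adm_continuous aP) s_gt0 d0.
  have h : r / 2 < r by rewrite ltr_pdivrMr// mulr_natr mulr2n ltrDl.
  near=> r' e => /= u' Phi' x' aP' cl x'x [r'0 /(_ s s_gt0) M].
  exfalso; move: M; apply/negP; rewrite -ltNge.
  have r'r : ball r d1 r' by near: r'; exact: nbhsx_ballx.
  have r'r2 : r / 2 <= r'.
    by apply: ltW; near: r'; exact: (lt_nbhsr h).
  have ed1 : e < d1 by near: e; exact: nbhs_right_lt.
  have ed2 : e < d2 by near: e; exact: nbhs_right_lt.
  have e_gt0 : 0 < e by near: e; exact: nbhs_right_gt.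
  have es : s `^ (beta - 1) * e < d.
    rewrite mulrC -ltr_pdivlMr ?powR_gt0//; near: e; apply: nbhs_right_lt.
    by rewrite divr_gt0// powR_gt0.
  (* This error grows as the radius shrinks; [r / 2 <= r'] bounds it uniformly in [r']. *)
  have er : r' `^ (beta - 1) * e < d.
    have : (r / 2) `^ (beta - 1) * e < d.
      rewrite mulrC -ltr_pdivlMr ?powR_gt0 ?divr_gt0//; near: e; apply: nbhs_right_lt.
      by rewrite divr_gt0// powR_gt0// divr_gt0.
    apply: le_lt_trans; rewrite ler_wpM2r ?(ltW e_gt0)//.
    rewrite -(opprB 1 beta) !powRN lef_pV2 ?posrE ?powR_gt0 ?divr_gt0//.
    by apply: ge0_ler_powR; rewrite ?nnegrE ?subr_ge0 ?(ltW beta_lt1) ?divr_ge0 ?(ltW r_gt0) ?(ltW r'0).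
  have /ler_normlP[c1 c2] := wdiff_close x' r' (fun t => (cl t).2).
  have /ler_normlP[c3 c4] := wdiff_close x' s (fun t => (cl t).2).
  have /ltr_normlP[c5 c6] : `|G Phi x r - G Phi x' r'| < d.
    by apply: B1 => //; rewrite distrC; exact: le_lt_trans ed1.
  have /ltr_normlP[c7 c8] : `|G Phi x s - G Phi x' s| < d.
    by apply: B2; rewrite ?subrr ?normr0// distrC; exact: le_lt_trans ed2.
  have dE : d * 4 = G Phi x s - G Phi x r by rewrite /d divfK.
  clearbody d; lra.
move/compact_near_coveringP: cK => /(_ R 0^'+ P _ main) NC.
near=> e => u' Phi' x' r' aP' cl x'x mr.
have Pe : [set` `[r0, R0]] `<=` P e by near: e; exact: NC.
apply: (Pe r' _ u' Phi' x') => //; rewrite /= in_itv/=.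
apply/negPn/negP; rewrite negb_and -!ltNge => rI.
have cl0 : close_by e0 u Phi u' Phi'.
  have ee0 : e <= e0 by near: e; exact: nbhs_right_ltW.
  by move=> t; have [/le_trans h1 /le_trans h2] := cl t; split; [exact: h1|exact: h2].
have x'1 : `|x'| <= `|x| + 1.
  have e1 : e <= 1 by near: e; exact: nbhs_right_ltW.
  have := ler_normD (x' - x) x; rewrite subrK; lra.
have [r'0 /(_ s0 s00)] := mr.
by apply/negP; rewrite -ltNge; exact: (H u').
Unshelve. all: by end_near. Qed.

End nearby_maximizers.

(** * Differentiability off a countable set *)

Section largest_radius.
Context {R : realType} (beta : R).
Hypotheses (beta_gt0 : 0 < beta) (beta_lt1 : beta < 1).
Implicit Types (u Phi : R -> R) (x r s e : R).
Local Notation G := (wdiff beta).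
Local Notation maxr := (maximizer beta).

Lemma is_derive_approx (f : R -> R) x (d eta : R) : is_derive x 1 f d -> 0 < eta ->
  exists2 e, 0 < e & forall y, `|y - x| < e ->
    `|f y - f x - d * (y - x)| <= eta * `|y - x|.
Proof.
move=> [fx fd] eta0.
have := fx; rewrite /derivable /= => /cvg_ex[l Hl].
have ld : l = d by rewrite -fd; apply/esym/cvg_lim.
rewrite ld in Hl.
have /cvgrPdist_le/(_ _ eta0)/nbhs_ballP[e /= e0 B] := Hl.
exists e => // y yx.
have [->|yNx] := eqVneq y x; first by rewrite !subrr mulr0 subr0 normr0 mulr0.
have yx0 : y - x != 0 by rewrite subr_eq0.
have := B (y - x); rewrite /ball /= sub0r normrN => /(_ yx yx0).
have -> : (y - x) *: (1 : R) = y - x by exact: mulr1.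
rewrite subrK => h.
rewrite [X in `|X|](_ : _ = - (d - (y - x)^-1 *: (f y - f x)) * (y - x)); last first.
  by rewrite /GRing.scale /=; field.
by rewrite normrM normrN ler_wpM2r.
Qed.

Lemma approx_is_derive (f : R -> R) x (d : R) :
  (forall eta : R, 0 < eta -> exists2 e, 0 < e & forall y, `|y - x| < e ->
    `|f y - f x - d * (y - x)| <= eta * `|y - x|) -> is_derive x 1 f d.
Proof.
move=> H.
have Hl : (fun h => h^-1 *: (f (h *: 1 + x) - f x)) @ 0^' --> d.
  apply/cvgrPdist_le => eta eta0; have [e e0 B] := H _ eta0.
  apply/nbhs_ballP; exists e => //= h; rewrite /ball /= sub0r normrN => he h0.
  rewrite /GRing.scale /= mulr1.
  have := B (h + x); rewrite addrK => /(_ he) k.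
  rewrite [X in `|X|](_ : _ = - (h^-1 * (f (h + x) - f x - d * h))); last by field.
  by rewrite normrN normrM normfV ler_pdivrMl ?normr_gt0// [leRHS]mulrC.
split; first by apply/cvg_ex; exists d.
exact/cvg_lim.
Qed.

Lemma wdiff_is_derive u Phi x r : admissible u Phi ->
  is_derive x 1 (fun y => G Phi y r) (G u x r).
Proof.
move=> aP.
have h1 : is_derive x 1 (fun y => Phi (y + r)) (u (x + r)).
  have := adm_derive aP (x + r); have := is_deriveD (is_derive_id x 1) (is_derive_cst r x 1).
  rewrite addr0 => h k; have := @is_derive1_comp R Phi (fun y => y + r) x (u (x + r)) 1 k h.
  by rewrite mulr1.
have h2 : is_derive x 1 (fun y => Phi (y - r)) (u (x - r)).
  have := adm_derive aP (x - r); have := is_deriveB (is_derive_id x 1) (is_derive_cst r x 1).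
  rewrite subr0 => h k; have := @is_derive1_comp R Phi (fun y => y - r) x (u (x - r)) 1 k h.
  by rewrite mulr1.
exact: (is_deriveZ (r `^ (beta - 1) / 2) (is_deriveB h1 h2)).
Qed.

Lemma wdiff_MVT u Phi x y r : admissible u Phi ->
  exists2 z, `|z - x| <= `|y - x| & G Phi y r - G Phi x r = G u z r * (y - x).
Proof.
move=> aP.
have cG : continuous (fun y => G Phi y r).
  move=> z; apply/differentiable_continuous/derivable1_diffP.
  by have [] := wdiff_is_derive z r aP.
have [xy|yx|->] := ltgtP x y; last first.
- by exists y; rewrite ?subrr ?normr0// mulr0.
- have [c] := MVT yx (fun x _ => wdiff_is_derive x r aP) (continuous_subspaceT cG).
  rewrite in_itv /= => /andP[c1 c2] E; exists c; last by lra.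
  rewrite !ltr0_norm; lra.
have [c] := MVT xy (fun x _ => wdiff_is_derive x r aP) (continuous_subspaceT cG).
rewrite in_itv /= => /andP[c1 c2] E; exists c => //.
by rewrite !gtr0_norm; lra.
Qed.

(** The largest maximizing radius. Every maximizing radius yields the same value [fracmax], but this
    choice is upper semicontinuous in [x], hence measurable. *)
Definition radius Phi x := sup [set r | maxr Phi x r].

Definition fracmax Phi x := G Phi x (radius Phi x).

(** If some [s] strictly beat the supremum, continuity in the radius would let it beat a maximizer
    close to the supremum. *)
Lemma radius_maximizer u Phi x : admissible u Phi -> maxr Phi x (radius Phi x).
Proof.
move=> aP.
have [r0 [R0 [e [s0 [[r00 e0 s00 rs sR] H]]]]] :=
  wdiff_concentrated beta_gt0 beta_lt1 aP (normr_ge0 x).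
have {}H r : maxr Phi x r -> r0 <= r <= R0.
  move=> [r_gt0 /(_ s0 s00) M]; apply/negPn/negP; rewrite negb_and -!ltNge => h.
  move: M; apply/negP; rewrite -ltNge; apply: (H u) => //.
  by move=> t; rewrite !subrr normr0 ltW.
pose S := [set r | maxr Phi x r].
have S0 : S !=set0 by have [r mr] := exists_maximizer beta_gt0 beta_lt1 x aP; exists r.
have hS : has_sup S by split => //; exists R0 => r /H/andP[].
have rad0 : 0 < radius Phi x.
  have [r mr] := S0; apply: lt_le_trans (ub_le_sup hS.2 mr).
  by apply: lt_le_trans r00 _; have /andP[] := H _ mr.
split => // s s_gt0; rewrite leNgt; apply/negP => lts.
have d0 : 0 < G Phi x s - G Phi x (radius Phi x) by rewrite subr_gt0.
have [d1 d10 B] := wdiff_continuity_modulus beta x (adm_continuous aP) rad0 d0.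
have [r mr rr] := sup_adherent d10 hS.
have rle : r <= radius Phi x by apply: (sup_upper_bound hS).
have /ltr_normlP[+ _] : `|G Phi x (radius Phi x) - G Phi x r| <
    G Phi x s - G Phi x (radius Phi x).
  apply: B; first by rewrite subrr normr0.
  by rewrite ger0_norm ?subr_ge0// ltrBlDl -ltrBlDr.
have [_ /(_ _ rad0)] := mr; have [_ /(_ _ s_gt0)] := mr; lra.
Qed.

Lemma fracmax_maximizer u Phi x r : admissible u Phi -> maxr Phi x r ->
  fracmax Phi x = G Phi x r.
Proof.
move=> aP [r0 mr]; have [q0 mq] := radius_maximizer x aP.
by apply/eqP; rewrite eq_le mr// mq.
Qed.

Lemma fracmax_ge u Phi x r : admissible u Phi -> 0 < r -> G Phi x r <= fracmax Phi x.
Proof. by move=> aP r0; have [_] := radius_maximizer x aP; apply. Qed.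

(** The kinks of the maximal function, seen as an upper envelope: two optimal branches cross at [x]
    with different slopes. *)
Definition exceptional u Phi := [set x | exists r r',
  [/\ maxr Phi x r, maxr Phi x r' & G u x r < G u x r']].

(** Off the exceptional set all maximizers at [x] share one slope, so being near any of them is
    enough and [maximizer_near] applies. The slope is evaluated at a point [z] distinct from the
    center [x'] because the mean value theorem only provides an intermediate point. *)
Lemma wdiff_dx_stable u Phi x r (eta : R) : admissible u Phi ->
  ~ exceptional u Phi x -> maxr Phi x r -> 0 < eta ->
  \forall e \near 0^'+, forall u' Phi' x' z r', admissible u' Phi' ->
    close_by e u Phi u' Phi' -> `|x' - x| <= e -> `|z - x| <= e ->
    maxr Phi' x' r' -> `|G u' z r' - G u x r| <= eta.
Proof.
move=> aP Nx mr eta0.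
pose W e r' := forall u' z, (forall t, `|u t - u' t| <= e) -> `|z - x| <= e ->
  `|G u' z r' - G u x r| <= eta.
have := @maximizer_near _ _ beta_gt0 beta_lt1 u Phi x W aP _.
suff HW : forall r, maxr Phi x r -> \forall r' \near r & e \near 0^'+, W e r'.
  move=> /(_ HW); apply: filterS => e He u' Phi' x' z r' aP' cl x'x zx mr'.
  by apply: (He u' Phi' x' r') => // t; have [] := cl t.
move=> r1 mr1.
have r1_gt0 : 0 < r1 by case: mr1.
have rr1 : G u x r = G u x r1.
  apply/eqP; rewrite eq_le !leNgt; apply/andP; split; apply/negP => h; apply: Nx.
    by exists r1, r.
  by exists r, r1.
have eta2 : 0 < eta / 2 by rewrite divr_gt0.
have [d1 d10 B] := wdiff_continuity_modulus beta x (adm_cont aP) r1_gt0 eta2.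
have h : r1 / 2 < r1 by rewrite ltr_pdivrMr// mulr_natr mulr2n ltrDl.
have h0 : 0 < r1 / 2 by rewrite divr_gt0.
near=> r' e => /= u' z cl zx.
have r'r : ball r1 d1 r' by near: r'; exact: nbhsx_ballx.
have r'r2 : r1 / 2 <= r' by apply: ltW; near: r'; exact: (lt_nbhsr h).
have r'0 : 0 < r' by exact: lt_le_trans r'r2.
have e_gt0 : 0 < e by near: e; exact: nbhs_right_gt.
have ed1 : e < d1 by near: e; exact: nbhs_right_lt.
have er : r' `^ (beta - 1) * e <= eta / 2.
  have : (r1 / 2) `^ (beta - 1) * e < eta / 2.
    rewrite mulrC -ltr_pdivlMr ?powR_gt0//; near: e; apply: nbhs_right_lt.
    by rewrite divr_gt0// powR_gt0.
  move/ltW; apply: le_trans; rewrite ler_wpM2r ?(ltW e_gt0)//.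
  rewrite -(opprB 1 beta) !powRN lef_pV2 ?posrE ?powR_gt0//.
  by apply: ge0_ler_powR; rewrite ?nnegrE ?subr_ge0 ?(ltW beta_lt1) ?(ltW h0) ?(ltW r'0).
have /ler_normlP[c1 c2] := wdiff_close beta z r' cl.
have /ltr_normlP[c5 c6] : `|G u x r1 - G u z r'| < eta / 2.
  by apply: B => //; rewrite distrC; exact: le_lt_trans ed1.
by apply/ler_normlP; split; lra.
Unshelve. all: by end_near. Qed.

(** Envelope argument: [fracmax Phi y - fracmax Phi x] lies between the increments
    of [wdiff Phi _ r] for a maximizing [r] at [x] and at [y] respectively. *)
Lemma fracmax_is_derive u Phi x r : admissible u Phi ->
  ~ exceptional u Phi x -> maxr Phi x r ->
  is_derive x 1 (fracmax Phi) (G u x r).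
Proof.
move=> aP Nx mr; apply: approx_is_derive => eta eta0.
have := wdiff_dx_stable aP Nx mr eta0.
rewrite near_withinE => /nbhs_ballP[e0 /= e00 H].
exists e0 => // y yx.
have [->|yNx] := eqVneq y x; first by rewrite !subrr mulr0 subr0 normr0 mulr0.
have yx0 : 0 < `|y - x| by rewrite normr_gt0 subr_eq0.
(* With the tolerance [|y - x|] the estimate covers [x], [y] and the mean value points between
   them. *)
have {}H : forall x' z r', `|x' - x| <= `|y - x| -> `|z - x| <= `|y - x| ->
    maxr Phi x' r' -> `|G u z r' - G u x r| <= eta.
  move=> x' z r'; apply: (H `|y - x| _ yx0 u Phi x' z r') => //.
    by rewrite /ball /= sub0r normrN normr_id.
  by move=> t; rewrite !subrr normr0.
have my := radius_maximizer y aP.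
have [z1 z1x E1] := wdiff_MVT x y r aP.
have [z2 z2x E2] := wdiff_MVT x y (radius Phi y) aP.
have [r_gt0 _] := mr; have [ry_gt0 _] := my.
have Fx := fracmax_maximizer aP mr; have Fy : fracmax Phi y = G Phi y (radius Phi y) by [].
have L1 : G u z1 r * (y - x) <= fracmax Phi y - fracmax Phi x.
  by rewrite -E1 Fx lerD2r (fracmax_ge _ aP).
have L2 : fracmax Phi y - fracmax Phi x <= G u z2 (radius Phi y) * (y - x).
  by rewrite -E2 Fy lerD2l lerN2 (fracmax_ge _ aP).
have x0 : `|x - x| <= `|y - x| by rewrite subrr normr0.
have B1 : `|(G u z1 r - G u x r) * (y - x)| <= eta * `|y - x|.
  by rewrite normrM ler_wpM2r//; exact: (H x).
have B2 : `|(G u z2 (radius Phi y) - G u x r) * (y - x)| <= eta * `|y - x|.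
  by rewrite normrM ler_wpM2r//; exact: (H y).
move: B1 B2 => /ler_normlP[b1 b2] /ler_normlP[b3 b4].
apply/ler_normlP; split; lra.
Qed.

(** If [p] is a rational number strictly between the slopes of two maximizing radii
    at [x], then [y |-> fracmax Phi y - p * y] has a strict local minimum at [x]. *)
Lemma countable_exceptional u Phi : admissible u Phi -> countable (exceptional u Phi).
Proof.
move=> aP.
pose F := fracmax Phi.
(* The rationals code an interval around [x] on which the minimum is strict, together with the
   slope; countability reduces to injectivity of this code. *)
have sep x : exceptional u Phi x -> exists t : rat * rat * rat,
    [/\ ratr t.1.1 < x, x < ratr t.1.2 & forall y, y != x ->
      ratr t.1.1 < y -> y < ratr t.1.2 ->
      F x - ratr t.2 * x < F y - ratr t.2 * y].
  move=> [r [r' [mr mr' lt]]].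
  have [p] := rat_in_itvoo lt; rewrite in_itv/= => /andP[p1 p2].
  have d1 : 0 < (ratr p - G u x r) / 2 by rewrite divr_gt0// subr_gt0.
  have d2 : 0 < (G u x r' - ratr p) / 2 by rewrite divr_gt0// subr_gt0.
  have [e1 e10 A1] := is_derive_approx (wdiff_is_derive x r aP) d1.
  have [e2 e20 A2] := is_derive_approx (wdiff_is_derive x r' aP) d2.
  have [a] := @rat_in_itvoo _ (x - e1) x ltac:(lra).
  have [b] := @rat_in_itvoo _ x (x + e2) ltac:(lra).
  rewrite !in_itv/= => /andP[xb be] /andP[ae ax].
  exists (a, b, p); split => //= y yx ay yb.
  have Fx := fracmax_maximizer aP mr; have Fx' := fracmax_maximizer aP mr'.
  have [r_gt0 _] := mr; have [r'_gt0 _] := mr'.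
  have Fy := fracmax_ge y aP r_gt0; have Fy' := fracmax_ge y aP r'_gt0.
  rewrite -/(F x) -/(F y) in Fx Fx' Fy Fy'.
  (* To the left of [x] the comparison is with [r], whose slope is below [p]; to the right with
     [r'], whose slope is above [p]. *)
  move: yx; rewrite neq_lt => /orP[yx|xy].
  - have /A1 : `|y - x| < e1 by rewrite ltr0_norm; lra.
    rewrite [X in _ <= _ * X]ltr0_norm ?subr_lt0// => /ler_normlP[k1 k2].
    have : 0 < (ratr p - G u x r) / 2 * (x - y) by rewrite mulr_gt0// subr_gt0.
    nra.
  - have /A2 : `|y - x| < e2 by rewrite gtr0_norm; lra.
    rewrite [X in _ <= _ * X]gtr0_norm ?subr_gt0// => /ler_normlP[k1 k2].
    have : 0 < (G u x r' - ratr p) / 2 * (y - x) by rewrite mulr_gt0// subr_gt0.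
    nra.
pose f x := if pselect (exceptional u Phi x) is left h then pickle (projT1 (cid (sep x h))) else 0%N.
apply/countable_injP; exists f => x y; rewrite !inE /f => Nx Ny.
case: pselect => // h1; case: pselect => // h2.
case: cid => /= t [t1 t2 t3]; case: cid => /= t' [t1' t2' t3'] /(pcan_inj pickleK) E.
rewrite -{t'}E in t1' t2' t3' *.
(* Two distinct points with the same code would each have the strictly smaller value. *)
apply/eqP/negPn/negP => xy.
have := t3 y; rewrite eq_sym => /(_ xy t1' t2').
by have := t3' x xy t1 t2; lra.
Qed.

End largest_radius.

(** * First-order condition and level sets *)

Section first_order.
Context {R : realType} (beta : R).
Hypotheses (beta_gt0 : 0 < beta) (beta_lt1 : beta < 1).
Implicit Types (u Phi : R -> R) (x r s e : R).
Local Notation G := (wdiff beta).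
Local Notation maxr := (maximizer beta).
Local Notation rad := (radius beta).

Definition ballavg Phi x r := (Phi (x + r) - Phi (x - r)) / (2 * r).

Lemma wdiff_ballavg Phi x r : 0 < r -> G Phi x r = r `^ beta * ballavg Phi x r.
Proof.
by move=> r0; rewrite /wdiff /ballavg -(powR_B1 beta_gt0 r0); field; rewrite gt_eqF.
Qed.

Lemma ballavg_mean u Phi x r : admissible u Phi -> 0 < r ->
  exists2 c, `|x - c| < r & ballavg Phi x r = u c.
Proof.
move=> aP r0; have [c xc E] := wdiff_mean beta_gt0 x aP r0; exists c => //.
have rb : r `^ beta != 0 by rewrite gt_eqF// powR_gt0.
by apply: (mulfI rb); rewrite -wdiff_ballavg.
Qed.

(** Strictness comes from concentration: the radius [r0 / 2] already has a nonnegative value and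
    loses strictly against [s0]. *)
Lemma maximizer_gt0 u Phi x r : admissible u Phi -> maxr Phi x r -> 0 < G Phi x r.
Proof.
move=> aP mr.
have [r0 [R0 [e [s0 [[r00 e0 s00 rs sR] H]]]]] :=
  wdiff_concentrated beta_gt0 beta_lt1 aP (normr_ge0 x).
have r20 : 0 < r0 / 2 by rewrite divr_gt0.
apply: lt_le_trans (mr.2 _ s00); apply: le_lt_trans (wdiff_ge0 beta x aP r20) _.
apply: (H u) => //; first by move=> t; rewrite !subrr normr0 ltW.
by rewrite ltr_pdivrMr// mulr_natr mulr2n ltrDl r00.
Qed.

Lemma maximizer_avg_gt0 u Phi x r : admissible u Phi -> maxr Phi x r ->
  0 < ballavg Phi x r.
Proof.
move=> aP mr; have := maximizer_gt0 aP mr; have [r0 _] := mr.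
by rewrite wdiff_ballavg// pmulr_rgt0// powR_gt0.
Qed.

(** The derivative of [wdiff] in the radius vanishes at an interior maximum; cancelling
    [r ^ (beta - 1)] turns the increment of [Phi] into the average. *)
Lemma maximizer_first_order u Phi x r : admissible u Phi -> maxr Phi x r ->
  u (x + r) + u (x - r) = 2 * (1 - beta) * ballavg Phi x r.
Proof.
move=> aP [r0 mr].
have dG s : 0 < s -> is_derive s 1 (G Phi x)
    ((beta - 1) * s `^ (beta - 1 - 1) / 2 * (Phi (x + s) - Phi (x - s)) +
     s `^ (beta - 1) / 2 * (u (x + s) + u (x - s))).
  move=> s0.
  have h1 : is_derive s 1 (fun y => Phi (x + y)) (u (x + s)).
    have := adm_derive aP (x + s); have := is_deriveD (is_derive_cst x s 1) (is_derive_id s 1).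
    rewrite add0r => h k; have := @is_derive1_comp R Phi (fun y => x + y) s (u (x + s)) 1 k h.
    by rewrite mulr1.
  have h2 : is_derive s 1 (fun y => Phi (x - y)) (- u (x - s)).
    have := adm_derive aP (x - s); have := is_deriveB (is_derive_cst x s 1) (is_derive_id s 1).
    rewrite sub0r => h k; have := @is_derive1_comp R Phi (fun y => x - y) s (u (x - s)) (-1) k h.
    by rewrite mulrN1.
  have h3 := is_deriveB h1 h2.
  have h4 : is_derive s 1 (fun y => y `^ (beta - 1) / 2) ((beta - 1) * s `^ (beta - 1 - 1) / 2).
    have := is_deriveZ (2^-1) (is_derive1_powR (beta - 1) s0).
    have -> : 2^-1 \*: (fun y : R => y `^ (beta - 1)) = (fun y : R => y `^ (beta - 1) / 2).
      by apply/funext => y /=; exact: mulrC.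
    by rewrite [_ *: _]mulrC.
  apply: (is_derive_eq (is_deriveM h4 h3)); rewrite /GRing.scale /= opprK.
  rewrite (_ : ((fun y => Phi (x + y)) - (fun y => Phi (x - y))) s =
    Phi (x + s) - Phi (x - s))//.
  ring.
have rI : r \in `]r / 2, r * 2[.
  by rewrite in_itv/= ltr_pdivrMr// mulr_natr mulr2n ltrDl r0.
have r20 : 0 < r / 2 by rewrite divr_gt0.
have r2r : r / 2 <= r * 2 by move: rI; rewrite in_itv/=; lra.
have := derive1_at_max r2r _ rI _.
have pos t : t \in `]r / 2, r * 2[ -> 0 < t.
  by rewrite in_itv/= => /andP[+ _]; exact: lt_trans.
move=> /(_ (G Phi x) (fun t tI => @ex_derive _ _ _ _ _ _ _ (dG t (pos t tI)))).
move=> /(_ (fun t tI => mr t (pos t tI))) D0.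
have : 'D_1 (G Phi x) r = 0 by exact: derive_val.
have -> : 'D_1 (G Phi x) r = (beta - 1) * r `^ (beta - 1 - 1) / 2 * (Phi (x + r) - Phi (x - r)) +
     r `^ (beta - 1) / 2 * (u (x + r) + u (x - r)) by have [] := dG r r0.
rewrite powRB; last by rewrite (gt_eqF r0) implybT.
rewrite powRr1 ?ltW// /ballavg => E.
have rb : r `^ (beta - 1) != 0 by rewrite gt_eqF// powR_gt0.
have rN0 : r != 0 by rewrite gt_eqF.
apply: (mulfI rb); move: E.
rewrite (_ : (beta - 1) * _ / 2 * _ + _ = r `^ (beta - 1) * (u (x + r) + u (x - r)) / 2 -
   r `^ (beta - 1) * (2 * (1 - beta) * ((Phi (x + r) - Phi (x - r)) / (2 * r))) / 2); last first.
  by field.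
lra.
Qed.

(** As [u] is nonnegative, the difference of its endpoint values is at most their sum, which the
    first-order condition evaluates. *)
Lemma maximizer_dx_bound u Phi x r : admissible u Phi -> maxr Phi x r ->
  `|G u x r| <= (1 - beta) * (r `^ (beta - 1) * ballavg Phi x r).
Proof.
move=> aP mr; have := maximizer_first_order aP mr; have [r0 _] := mr.
rewrite /wdiff normrM ger0_norm ?divr_ge0 ?powR_ge0// => E.
have h : `|u (x + r) - u (x - r)| <= 2 * ((1 - beta) * ballavg Phi x r).
  rewrite mulrA -E; have := adm_ge0 aP (x + r); have := adm_ge0 aP (x - r).
  by move=> ? ?; apply/ler_normlP; split; lra.
rewrite mulrCA -mulrA ler_wpM2l ?powR_ge0//; lra.
Qed.

Lemma compact_max_id (A : set R) : A !=set0 -> compact A ->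
  exists2 c, A c & forall t, A t -> t <= c.
Proof.
move=> A0 cA; have [|c cA' cM] := @compact_EVT_max R R id A A0 cA.
  by apply: continuous_subspaceT => ?; exact: cvg_id.
by exists c; [exact: set_mem|move=> t At; apply: cM; exact: mem_set].
Qed.

(** Take for [p'] the last point of [[p, q]] with value at most [a], then for [q'] the first point
    after it with value at least [b]. *)
Lemma upcrossing (v : R -> R) (p q a b : R) : continuous v -> p < q ->
  v p <= a -> a < b -> b <= v q ->
  exists p' q', [/\ p <= p', p' < q', q' <= q, v p' <= a & b <= v q'] /\
    forall t, p' < t < q' -> a < v t < b.
Proof.
move=> cv pq vpa ab bvq.
have clA : closed [set t | v t <= a] by apply: (@closed_comp _ _ v [set t | t <= a]) => [t _|]; [exact: cv|exact: closed_le].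
have clB : closed [set t | b <= v t] by apply: (@closed_comp _ _ v [set t | b <= t]) => [t _|]; [exact: cv|exact: closed_ge].
have [||p' [p'I vp'] p'M] := @compact_max_id (`[p, q] `&` [set t | v t <= a]).
- by exists p; split => //=; rewrite in_itv/= lexx ltW.
- exact: compact_closedI (@segment_compact _ _ _) clA.
move: p'I; rewrite /= in_itv/= => /andP[pp' p'q].
(* The first point is found as the maximum of the reflected set. *)
have cN : compact (-%R @` (`[p', q] `&` [set t | b <= v t])).
  apply: continuous_compact; last exact: compact_closedI (@segment_compact _ _ _) clB.
  by apply: continuous_subspaceT => t; exact: opp_continuous.
have N0 : -%R @` (`[p', q] `&` [set t | b <= v t]) !=set0.
  by exists (- q), q => //; split => //=; rewrite in_itv/= lexx andbT.
have [_ [q' [q'I vq'] <-] q'M] := compact_max_id N0 cN.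
move: q'I; rewrite /= in_itv/= => /andP[p'q' q'q].
exists p', q'; split; first split => //.
  rewrite lt_neqAle p'q' andbT; apply/eqP => E; rewrite -E in vq'.
  by have := le_lt_trans vp' ab; rewrite ltNge vq'.
move=> t /andP[p't tq']; apply/andP; split; rewrite ltNge; apply/negP => vt.
  have : t <= p'.
    apply: p'M; split => //=; rewrite in_itv/= (le_trans pp' (ltW p't))/=.
    exact: le_trans (ltW tq') q'q.
  by rewrite leNgt p't.
have : - t <= - q'.
  apply: q'M; exists t => //; split => //=; rewrite in_itv/= (ltW p't)/=.
  exact: le_trans (ltW tq') q'q.
by rewrite lerN2 leNgt tq'.
Qed.

Lemma crossing (v : R -> R) (p q a b : R) : continuous v -> p != q ->
  v p <= a -> a < b -> b <= v q ->
  exists p' q', [/\ Num.min p q <= p', p' < q', q' <= Num.max p q,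
    b - a <= `|v q' - v p'| & forall t, p' < t < q' -> a < v t < b].
Proof.
move=> cv + va ab bv; rewrite neq_lt => /orP[pq|qp].
  have [p' [q' [[h1 h2 h3 h4 h5] h6]]] := upcrossing cv pq va ab bv.
  exists p', q'; rewrite min_l ?max_r ?(ltW pq)//; split => //.
  by rewrite (le_trans _ (ler_norm _))//; lra.
have cv' : continuous (v \o -%R).
  by move=> t; apply: continuous_comp; [exact: opp_continuous|exact: cv].
have [|||p' [q' [[h1 h2 h3 h4 h5] h6]]] := @upcrossing _ (- p) (- q) a b cv' _ _ ab.
- by rewrite ltrN2.
- by rewrite /= opprK.
- by rewrite /= opprK.
exists (- q'), (- p'); rewrite min_r ?max_l ?(ltW qp)//; split => //.
- by rewrite lerNr.
- by rewrite ltrN2.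
- by rewrite lerNl.
- rewrite distrC (le_trans _ (ler_norm _))//; move: h4 h5 => /=; lra.
- move=> t /andP[t1 t2]; have := h6 (- t); rewrite /= opprK; apply.
  by apply/andP; split; lra.
Qed.

(** [maximizer_near], applied to the open condition [r' < - a], shows that the largest maximizing
    radius is upper semicontinuous. *)
Lemma measurable_radius u Phi : admissible u Phi -> measurable_fun setT (rad Phi).
Proof.
move=> aP.
suff /lower_semicontinuous_measurable : lower_semicontinuous (fun x => (- rad Phi x)%:E).
  move/measurable_EFinP => /(measurableT_comp (@oppr_measurable R setT)); congr measurable_fun.
  by apply/funext => x /=; rewrite opprK.
suff H : forall x a, a < - rad Phi x -> exists2 V, nbhs x V & forall y, V y -> a < - rad Phi y.
  by move=> x a; rewrite lte_fin => /H[V xV VH]; exists V => // y /VH; rewrite lte_fin.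
move=> x a ax.
have xa : rad Phi x < - a by rewrite ltrNr.
have := @maximizer_near _ _ beta_gt0 beta_lt1 u Phi x (fun _ r' => r' < - a) aP _.
have W : forall r, maxr Phi x r -> \forall r' \near r & _ \near (0:R)^'+, r' < - a.
  move=> r mr.
  have ra : r < - a.
    apply: le_lt_trans xa; apply: (sup_upper_bound _) => //.
    split; first by exists r.
    have [r0 [R0 [e [s0 [[r00 e0 s00 rs sR] H]]]]] :=
      wdiff_concentrated beta_gt0 beta_lt1 aP (normr_ge0 x).
    exists R0 => r' [r'0 /(_ s0 s00) M]; rewrite leNgt; apply/negP => h; move: M.
    apply/negP; rewrite -ltNge; apply: (H u) => //; last by rewrite h orbT.
    by move=> t; rewrite !subrr normr0 ltW.
  exists ([set r' | r' < - a], setT) => /=; last by move=> [? ?] [].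
  by split; [exact: lt_nbhsl|exact: filterT].
move=> /(_ W); rewrite near_withinE => /nbhs_ballP[e0 /= e00 H].
have e20 : 0 < e0 / 2 by rewrite divr_gt0.
exists (ball x (e0 / 2)); first exact: nbhsx_ballx.
move=> y xy; rewrite ltrNr; apply: (H (e0 / 2) _ e20 u Phi y) => //.
- rewrite /ball /= sub0r normrN gtr0_norm//; lra.
- by move=> t; rewrite !subrr normr0 ltW.
- by rewrite distrC ltW.
- exact: radius_maximizer aP.
Qed.

(** On this set [u y] and the average at the center agree up to the factor [1 - beta], which makes
    two centers sharing [y] comparable. *)
Definition level u Phi x := [set y | `|x - y| < rad Phi x /\
  (1 - beta) * ballavg Phi x (rad Phi x) < u y < ballavg Phi x (rad Phi x)].

(** If [y] lies in the level sets of [x] and [x'], with radii [r <= s], then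
    [B(x', s)] is contained in [B(x, 3 s)], so that maximality of [r] gives
    [3 ^ (beta - 1) * s ^ beta * u y <= r ^ beta * u y / (1 - beta)]. *)
Definition scale_ratio := ((1 - beta) * 3 `^ (beta - 1)) `^ beta^-1.

Lemma scale_ratio_gt0 : 0 < scale_ratio.
Proof. by rewrite powR_gt0// mulr_gt0 ?powR_gt0// subr_gt0. Qed.

Lemma scale_ratio_le1 : scale_ratio <= 1.
Proof.
have b1 : 0 < 1 - beta by rewrite subr_gt0.
have h3 : (3 : R) `^ (beta - 1) <= 1.
  rewrite -(opprB 1 beta) powRN invf_le1 ?powR_gt0//.
  by rewrite -[leLHS](powRr0 (3:R)); apply: ler_powR; rewrite ?ler1n// ltW.
have h : (1 - beta) * 3 `^ (beta - 1) <= 1.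
  by rewrite mulr_ile1 ?powR_ge0 ?(ltW b1)// gerBl ltW.
have h0 : 0 <= (1 - beta) * 3 `^ (beta - 1) by rewrite mulr_ge0 ?powR_ge0 ?ltW.
have ib : 0 <= beta^-1 by rewrite invr_ge0 ltW.
by have := ge0_ler_powR ib; move=> /(_ _ _ _ _ h); rewrite powR1 !nnegrE; apply.
Qed.

Lemma level_radius u Phi x x' y : admissible u Phi ->
  level u Phi x y -> level u Phi x' y -> scale_ratio * rad Phi x' <= rad Phi x.
Proof.
move=> aP [xy /andP[u1 u2]] [xy' /andP[u1' u2']].
have mx := radius_maximizer beta_gt0 beta_lt1 x aP.
have mx' := radius_maximizer beta_gt0 beta_lt1 x' aP.
move: mx mx' xy u1 u2 xy' u1' u2'.
set r := rad Phi x; set S := rad Phi x' => mx mx' xy u1 u2 xy' u1' u2'.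
have [r0 mr] := mx; have [S0 _] := mx'.
have b1 : 0 < 1 - beta by rewrite subr_gt0.
have [Sr|rS] := lerP S r.
  by rewrite (le_trans _ Sr)// ler_piMl ?scale_ratio_le1// ltW.
have B0 := maximizer_avg_gt0 aP mx.
have uy0 : 0 < u y by apply: lt_trans u1; rewrite mulr_gt0.
have S30 : 0 < 3 * S by rewrite mulr_gt0.
have G3 : 3 `^ (beta - 1) * (S `^ beta * u y) <= G Phi x (3 * S).
  rewrite (@le_trans _ _ (3 `^ (beta - 1) * (S `^ beta * ballavg Phi x' S)))//.
    by rewrite ler_wpM2l ?powR_ge0// ler_wpM2l ?powR_ge0// ltW.
  rewrite -wdiff_ballavg// /wdiff powRM ?(ltW S0)// !mulrA ler_wpM2l//.
    by rewrite !mulr_ge0 ?powR_ge0.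
  move: xy xy' => /ltr_normlP[a1 a2] /ltr_normlP[a3 a4].
  have h1 : Phi (x' + S) <= Phi (x + 3 * S) by apply: adm_ndecr aP _; lra.
  have h2 : Phi (x - 3 * S) <= Phi (x' - S) by apply: adm_ndecr aP _; lra.
  by lra.
have L : (1 - beta) * G Phi x r <= r `^ beta * u y.
  by rewrite wdiff_ballavg// mulrCA ler_wpM2l ?powR_ge0// ltW.
have : (1 - beta) * 3 `^ (beta - 1) * S `^ beta <= r `^ beta.
  rewrite -(ler_pM2r uy0) -(mulrA (1 - beta)) -(mulrA (1 - beta)) -mulrA (le_trans _ L)// ler_wpM2l ?(ltW b1)//.
  by rewrite (le_trans G3)// mr.
have h0 : 0 <= (1 - beta) * 3 `^ (beta - 1) by rewrite mulr_ge0 ?powR_ge0 ?ltW.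
have -> : (1 - beta) * 3 `^ (beta - 1) = scale_ratio `^ beta.
  by rewrite -powRrM mulVf ?gt_eqF// powRr1.
rewrite -powRM ?(ltW scale_ratio_gt0) ?(ltW S0)// leNgt => h; rewrite leNgt.
apply/negP => h2; move/negP: h; apply; apply: gt0_ltr_powR => //.
- by rewrite nnegrE ltW.
- by rewrite nnegrE mulr_ge0 ?(ltW scale_ratio_gt0) ?(ltW S0).
Qed.

End first_order.

(** * Measurability of level sets and variation on them *)

Section level_sets.
Context {R : realType} (beta : R).
Hypotheses (beta_gt0 : 0 < beta) (beta_lt1 : beta < 1).
Implicit Types (u Phi : R -> R) (x r s e : R).
Local Notation G := (wdiff beta).
Local Notation maxr := (maximizer beta).
Local Notation mu := (@lebesgue_measure R).
Local Notation rad := (radius beta).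
Local Notation q := (1 / (1 - beta)).

(** [d] stands for the size of the derivative of [u]. It is kept separate from [|df|] so that the
    same estimates can run with [|dg - df|] when the representative of [f] vanishes. *)
Definition var_bound u (d : R -> R) :=
  [/\ measurable_fun setT d, forall x, 0 <= d x &
    forall x y, x <= y -> (`|u y - u x|%:E <= \int[mu]_(t in `[x, y]) (d t)%:E)%E].

Lemma measurable_set_lt d (T : measurableType d) (f g : T -> R) :
  measurable_fun setT f -> measurable_fun setT g -> measurable [set x | f x < g x].
Proof.
move=> mf mg; have := measurable_fun_ltr mf mg measurableT (Y := [set true]) I.
by rewrite setTI; congr measurable; apply/seteqP; split => x /=.
Qed.

Lemma measurable_powR_comp d (T : measurableType d) (f : T -> R) (D : set T) p :
  measurable_fun D f -> measurable_fun D (fun t => f t `^ p).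
Proof.
by move=> mf; exact: (@measurableT_comp _ _ _ _ _ _ (fun t : R => t `^ p) D f).
Qed.

Lemma measurable_center_avg u Phi : admissible u Phi ->
  measurable_fun setT (fun x => ballavg Phi x (rad Phi x)).
Proof.
move=> aP; have mr := measurable_radius beta_gt0 beta_lt1 aP.
have mPhi := continuous_measurable_fun (adm_continuous aP).
(* Division by the positive radius is written as the power [-1], which [measurable_powR_comp]
   covers. *)
apply: (eq_measurable_fun (fun x => (Phi (x + rad Phi x) - Phi (x - rad Phi x)) *
   (2 * rad Phi x) `^ (-1))).
  move=> x _; rewrite powR_inv1// mulr_ge0// ltW//.
  by have [] := radius_maximizer beta_gt0 beta_lt1 x aP.
apply: measurable_funM.
  apply: measurable_funB; apply: measurableT_comp => //.
    exact: measurable_funD.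
  exact: measurable_funB.
apply: measurable_powR_comp.
exact: measurable_funM.
Qed.

Lemma measurable_wdiff_radius u Phi (v : R -> R) : admissible u Phi ->
  continuous v -> measurable_fun setT (fun x => G v x (rad Phi x)).
Proof.
move=> aP /continuous_measurable_fun mv.
have mr := measurable_radius beta_gt0 beta_lt1 aP.
apply: measurable_funM.
  apply: measurable_funM => //.
  exact: measurable_powR_comp.
apply: measurable_funB; apply: measurableT_comp => //.
  exact: measurable_funD.
exact: measurable_funB.
Qed.

Lemma measurable_level u Phi : admissible u Phi ->
  measurable [set z : R * R | level beta u Phi z.1 z.2].
Proof.
move=> aP; have mr := measurable_radius beta_gt0 beta_lt1 aP.
have mB := measurable_center_avg aP.
have mu' := continuous_measurable_fun (adm_cont aP).
have -> : [set z : R * R | level beta u Phi z.1 z.2] =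
  [set z | `|z.1 - z.2| < rad Phi z.1] `&`
  ([set z | (1 - beta) * ballavg Phi z.1 (rad Phi z.1) < u z.2] `&`
   [set z | u z.2 < ballavg Phi z.1 (rad Phi z.1)]).
  apply/seteqP; split => z /=; rewrite /level/=.
    by move=> [-> /andP[-> ->]].
  by move=> [-> [-> ->]].
have mB1 : measurable_fun setT (fun z : R * R => ballavg Phi z.1 (rad Phi z.1)).
  exact: (measurableT_comp mB measurable_fst).
have mu2 : measurable_fun setT (fun z : R * R => u z.2).
  exact: (measurableT_comp mu' measurable_snd).
apply: measurableI; last apply: measurableI.
- apply: measurable_set_lt; last exact: (measurableT_comp mr measurable_fst).
  by apply: measurableT_comp => //; apply: measurable_funB; [exact: measurable_fst|exact: measurable_snd].
- apply: measurable_set_lt => //; exact: measurable_funM.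
- exact: measurable_set_lt.
Qed.

Lemma measurable_level1 u Phi x : admissible u Phi -> measurable (level beta u Phi x).
Proof.
move=> /measurable_level/measurable_xsection => /(_ x); congr measurable.
by apply/seteqP; split => y; rewrite /xsection/= inE.
Qed.

(** By the first-order condition [u] is at most [(1 - beta)] times its average at an
    endpoint of the ball, while it attains its average inside. *)
Lemma level_variation u Phi d x : admissible u Phi -> var_bound u d ->
  ((beta * ballavg Phi x (rad Phi x))%:E <= \int[mu]_(t in level beta u Phi x) (d t)%:E)%E.
Proof.
move=> aP [md d0 ud].
have mx := radius_maximizer beta_gt0 beta_lt1 x aP.
have [r0 _] := mx; set r := rad Phi x in mx r0 *.
set B := ballavg Phi x r.
have B0 : 0 < B := maximizer_avg_gt0 beta_gt0 beta_lt1 aP mx.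
have [c /ltr_normlP[c1 c2] Ec] := ballavg_mean beta_gt0 x aP r0.
have FO := maximizer_first_order aP mx.
have aB : (1 - beta) * B < B by rewrite gtr_pMl// gtrBl.
have [p [pc px up]] : exists p, [/\ p != c, `|x - p| <= r & u p <= (1 - beta) * B].
  have [h|h] := lerP (u (x + r)) ((1 - beta) * B).
    exists (x + r); split => //; first by rewrite gt_eqF//; lra.
    by rewrite opprD addrA subrr add0r normrN gtr0_norm.
  exists (x - r); split => //; first by rewrite lt_eqF//; lra.
    by rewrite opprB addrC subrK gtr0_norm.
  move: FO; rewrite -/B; lra.
(* The crossing runs between an endpoint and the point [c] where [u] equals its average; it stays in
   the ball, and [u] changes by at least [B - (1 - beta) * B] along it. *)
have [p' [q' [h1 h2 h3 h4 h5]]] := crossing (adm_cont aP) pc up aB (eq_ind _ (fun t => is_true (B <= t)) (lexx B) _ Ec).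
apply: (@le_trans _ _ (`|u q' - u p'|%:E)); first by rewrite lee_fin; lra.
apply: le_trans (ud _ _ (ltW h2)) _.
have mdE D : measurable_fun D (fun t => (d t)%:E).
  by apply/measurable_EFinP; exact: measurable_funS md.
(* Only the open interval lies in the level set, whose inequalities are strict. *)
rewrite integral_itv_bndoo//.
apply: (ge0_subset_integral mu (measurable_itv _) (measurable_level1 x aP) (mdE _)) => [t _|].
  by rewrite lee_fin.
move=> t /=; rewrite in_itv/= => tI; split; last exact: h5.
move: tI px h1 h3 => /andP[t1 t2] /ler_normlP[k1 k2].
rewrite -/r ge_min le_max => /orP[?|?] /orP[?|?]; apply/ltr_normlP; split; lra.
Qed.

(** An integrable function is arbitrarily small somewhere on each side of [x], so climbing to [v x]
    and coming down again costs [2 * v x] of variation. *)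
Lemma level_sup_bound (v d : R -> R) x : (forall x, 0 <= v x) -> var_bound v d ->
  mu.-integrable setT (EFin \o v) ->
  ((2 * v x)%:E <= \int[mu]_t (d t)%:E)%E.
Proof.
move=> v0 [md d0 ud] iv.
have mdE D : measurable_fun D (fun t => (d t)%:E).
  by apply/measurable_EFinP; exact: measurable_funS md.
have dE0 t : (0 <= (d t)%:E)%E by rewrite lee_fin.
(* A lower bound [e] on a half-line would contradict integrability. *)
have small (I : interval R) (e : R) : mu [set` I] = +oo%E -> 0 < e ->
    exists2 y, y \in I & v y <= e.
  move=> muI e0; apply: contrapT => H.
  have Ie y : [set` I] y -> e <= v y.
    by move=> Iy; rewrite leNgt; apply/negP => /ltW h; apply: H; exists y.
  have /integrableP[_] : mu.-integrable [set` I] (EFin \o v) by exact: integrableS iv.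
  apply/negP; rewrite -leNgt.
  have <- : (\int[mu]_(y in [set` I]) (cst e%:E) y = +oo)%E.
    by rewrite integral_cst//= muI gt0_muley.
  apply: ge0_le_integral => //.
  - by move=> y _; rewrite lee_fin ltW.
  - apply: measurableT_comp => //; have /integrableP[+ _] := iv.
    exact: measurable_funS.
  - by move=> y Iy; rewrite lee_fin (le_trans (Ie _ Iy))// ler_norm.
apply/lee_addgt0Pr => e e0.
have e20 : 0 < e / 2 by rewrite divr_gt0.
have [y] : exists2 y, y \in `]-oo, x[ & v y <= e / 2 by apply: small => //; rewrite lebesgue_measure_itv/= ?ltNyr ?ltry.
have [z] : exists2 y, y \in `]x, +oo[ & v y <= e / 2 by apply: small => //; rewrite lebesgue_measure_itv/= ?ltNyr ?ltry.
rewrite !in_itv/= andbT => xz vz yx vy.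
have h1 := ud _ _ (ltW yx); have h2 := ud _ _ (ltW xz).
have h3 : (\int[mu]_(t in `[y, x]) (d t)%:E + \int[mu]_(t in `[x, z]) (d t)%:E <=
    \int[mu]_t (d t)%:E)%E.
  rewrite integral_itv_bndoo// [X in (_ + X <= _)%E]integral_itv_bndoo//.
  rewrite -ge0_integral_setU//=.
  - by apply: (ge0_subset_integral mu _ measurableT (mdE _)) => //; apply: measurableU.
  - exact: mdE.
  - apply/disj_setPS => t [] /=; rewrite !in_itv/= => /andP[_ t1] /andP[t2 _].
    by have := lt_trans t1 t2; rewrite ltxx.
rewrite (@le_trans _ _ (`|v x - v y|%:E + `|v z - v x|%:E + e%:E)%E)//; last first.
  by apply: leeD => //; apply: le_trans h3; exact: leeD.
rewrite -!EFinD lee_fin.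
have := ler_norm (v x - v y); have := ler_norm (v x - v z); rewrite (distrC (v x) (v z)); lra.
Qed.

(** Here [(beta - 1) * q = - 1] produces the factor [1 / r]. One power of the average is split off
    for [level_variation] to replace by an integral of [d]. *)
Lemma maximizer_dx_pow u Phi x r : admissible u Phi -> maxr Phi x r ->
  `|G u x r| `^ q <= (1 - beta) `^ q * (r `^ (-1) * ballavg Phi x r `^ (q - 1)) * ballavg Phi x r.
Proof.
move=> aP mr; have [r0 _] := mr; have b1 : 0 < 1 - beta by rewrite subr_gt0.
have B0 := maximizer_avg_gt0 beta_gt0 beta_lt1 aP mr.
have q0 : 0 <= q by rewrite div1r invr_ge0 ltW.
apply: le_trans (ge0_ler_powR q0 _ _ (maximizer_dx_bound aP mr)) _.
- by rewrite nnegrE.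
- by rewrite nnegrE; apply: mulr_ge0; [exact: ltW|apply: mulr_ge0; [exact: powR_ge0|exact: ltW]].
have h0 : 0 <= r `^ (beta - 1) * ballavg Phi x r := mulr_ge0 (powR_ge0 _ _) (ltW B0).
rewrite (powRM q (ltW b1) h0) (powRM q (powR_ge0 _ _) (ltW B0)) -!mulrA -powRrM.
rewrite (_ : (beta - 1) * q = -1); last by field; rewrite gt_eqF.
by rewrite [_ `^ (q - 1) * _]mulrC mulr_powRB1// ?(ltW B0)// div1r invr_gt0.
Qed.

(** * Tonelli estimate for the slopes *)

Section tonelli.
Variables (u Phi d : R -> R).
Hypotheses (aP : admissible u Phi) (ud : var_bound u d).
Local Notation B x := (ballavg Phi x (rad Phi x)).
Local Notation L := [set z : R * R | level beta u Phi z.1 z.2].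

(** What remains of the bound of [maximizer_dx_pow] once its last factor is estimated by the
    integral of [d] over the level set, divided by [beta]. *)
Let w x := (1 - beta) `^ q / beta * (rad Phi x `^ (-1) * B x `^ (q - 1)).

Let w_ge0 x : 0 <= w x.
Proof. by rewrite !mulr_ge0 ?powR_ge0 ?invr_ge0// ltW. Qed.

Let measurable_w : measurable_fun setT w.
Proof.
apply: measurable_funM => //; apply: measurable_funM.
  apply: measurable_powR_comp; exact: (measurable_radius beta_gt0 beta_lt1 aP).
apply: measurable_powR_comp; exact: (measurable_center_avg aP).
Qed.

(** Integrated in the second variable, this kernel dominates the slope at a center in [E];
    integrated in the first, it collects all centers whose level set contains a given point. *)
Let K (E : set R) (z : R * R) : \bar R := (\1_E z.1 * w z.1 * d z.2 * \1_L z)%:E.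

Let K_ge0 E z : (0 <= K E z)%E.
Proof. by have [_ d0 _] := ud; rewrite lee_fin; apply: mulr_ge0; rewrite ?indicE//; apply: mulr_ge0 => //; apply: mulr_ge0; rewrite ?indicE. Qed.

Let measurable_K E : measurable E -> measurable_fun setT (K E).
Proof.
move=> mE; have [md _ _] := ud; apply/measurable_EFinP; apply: measurable_funM.
  apply: measurable_funM; last exact: (measurableT_comp md measurable_snd).
  apply: measurable_funM; last exact: (measurableT_comp measurable_w measurable_fst).
  by apply: (measurableT_comp _ measurable_fst); exact: measurable_indic.
by apply: measurable_indic; exact: (measurable_level aP).
Qed.

Let dx_le_inner E x : E x ->
  ((`|G u x (rad Phi x)| `^ q)%:E <= \int[mu]_y K E (x, y))%E.
Proof.
move=> Ex; have [md d0 _] := ud.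
have mx := radius_maximizer beta_gt0 beta_lt1 x aP.
have b1 : 0 < 1 - beta by rewrite subr_gt0.
have mdE D : measurable_fun D (fun t => (d t)%:E).
  by apply/measurable_EFinP; exact: measurable_funS md.
have -> : (\int[mu]_y K E (x, y) = (w x)%:E * \int[mu]_(y in level beta u Phi x) (d y)%:E)%E.
  rewrite -(@ge0_integralZl _ _ _ mu _ (measurable_level1 x aP) _ (mdE _) (w x)%:E) ?lee_fin//; last first.
    by move=> y _; rewrite lee_fin.
  rewrite [RHS]integral_mkcond; apply: eq_integral => y _.
  rewrite patchE /K /= indicE mem_set// mul1r indicE -EFinM.
  rewrite (_ : ((x, y) \in L) = (y \in level beta u Phi x)).
    by case: ifPn => _; rewrite ?mulr1 ?mulr0.
  by apply/idP/idP; rewrite !inE.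
apply: (@le_trans _ _ ((w x)%:E * (beta * B x)%:E)%E); last first.
  by apply: lee_wpmul2l; [rewrite lee_fin|exact: level_variation].
rewrite -EFinM lee_fin; apply: le_trans (maximizer_dx_pow aP mx) _.
rewrite /w le_eqVlt; apply/orP; left; apply/eqP; field.
by rewrite !gt_eqF.
Qed.

(** Fix one center [x0] whose level set contains [y], with radius [r]. By [level_radius], used in
    both directions, every other such center has radius between [k * r] and [r / k]. These centers
    lie in a ball of length [2 * r / k] and carry weights [1 / radius] of at most [1 / (k * r)], so
    [r] cancels and [2 / k ^ 2] remains. *)
Let outer_le E (Lam : R -> R) y : measurable E -> (forall y, 0 <= Lam y) ->
  (forall x y, E x -> level beta u Phi x y -> B x `^ (q - 1) <= Lam y) ->
  (\int[mu]_x K E (x, y) <=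
   ((1 - beta) `^ q / beta * (2 * (scale_ratio beta) ^- 2) * (Lam y * d y))%:E)%E.
Proof.
move=> mE Lam0 HLam; have [md d0 _] := ud.
have k0 := scale_ratio_gt0 beta_lt1; set k := scale_ratio beta in k0 *.
have [[x0 [Ex0 Lx0]]|nL] := pselect (exists x, E x /\ level beta u Phi x y); last first.
  rewrite integral0_eq.
    by rewrite lee_fin !mulr_ge0 ?powR_ge0 ?invr_ge0 ?exprn_ge0// ltW.
  move=> x _; rewrite /K/= !indicE.
  have [xE|_] := boolP (x \in E); last by rewrite !mul0r.
  have [xL|_] := boolP ((x, y) \in L); last by rewrite mulr0.
  by exfalso; apply: nL; exists x; split; [exact: set_mem xE|exact: set_mem xL].
have [r0 _] := radius_maximizer beta_gt0 beta_lt1 x0 aP.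
set r := rad Phi x0 in r0.
pose c := (1 - beta) `^ q / beta * ((k * r)^-1 * Lam y) * d y.
have kr0 : 0 < k * r by rewrite mulr_gt0.
have c0 : 0 <= c by rewrite !mulr_ge0 ?powR_ge0 ?invr_ge0// ltW.
apply: (@le_trans _ _ (\int[mu]_(x in ball y (r / k)) (cst c%:E) x)%E); last first.
  rewrite integral_cst; last exact: measurable_ball.
  have rk0 : 0 <= r / k by rewrite divr_ge0// ltW.
  rewrite /= lebesgue_measure_ball// -EFinM lee_fin.
  rewrite le_eqVlt; apply/orP; left; apply/eqP; rewrite /c -mulr_natr; field.
  by rewrite !gt_eqF.
rewrite [leRHS]integral_mkcond; apply: ge0_le_integral => //.
- exact: (measurableT_comp (measurable_K mE)
    (measurable_fun_pair (@measurable_id _ _ setT) (measurable_cst y))).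
- by apply/measurable_restrict => //; exact: measurable_ball.
move=> x _; rewrite /K/= patchE !indicE.
have [xE|_] := boolP (x \in E); last first.
  by rewrite !mul0r; case: ifP => //; rewrite lee_fin.
have [xL|_] := boolP ((x, y) \in L); last first.
  by rewrite mulr0; case: ifP => //; rewrite lee_fin.
rewrite mul1r mulr1.
move: xE xL => /set_mem Ex /set_mem Lx.
have [rx0 _] := radius_maximizer beta_gt0 beta_lt1 x aP.
have h1 := level_radius beta_gt0 beta_lt1 aP Lx Lx0.
have h2 := level_radius beta_gt0 beta_lt1 aP Lx0 Lx.
rewrite mem_set; last first.
  rewrite /ball /= distrC; have [xy _] := Lx; apply: lt_le_trans xy _.
  by rewrite ler_pdivlMr// mulrC.
rewrite lee_fin /c /w; apply: ler_wpM2r => //; apply: ler_wpM2l.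
  by rewrite divr_ge0 ?powR_ge0// ltW.
apply: ler_pM; rewrite ?powR_ge0//; last exact: HLam.
by rewrite powR_inv1 ?(ltW rx0)// lef_pV2.
Qed.

(** The bound [Lam] on the power of the average may depend on the point [y], not on the center: the
    tail estimate needs different bounds for near and far points. *)
Lemma level_tonelli E (Lam : R -> R) : measurable E -> measurable_fun setT Lam ->
  (forall y, 0 <= Lam y) ->
  (forall x y, E x -> level beta u Phi x y -> B x `^ (q - 1) <= Lam y) ->
  (\int[mu]_(x in E) (`|G u x (rad Phi x)| `^ q)%:E <=
   ((1 - beta) `^ q / beta * (2 * (scale_ratio beta) ^- 2))%:E *
   \int[mu]_y (Lam y * d y)%:E)%E.
Proof.
move=> mE mLam Lam0 HLam; have [md d0 _] := ud.
have mK := measurable_K mE.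
have C0 : 0 <= (1 - beta) `^ q / beta * (2 * (scale_ratio beta) ^- 2).
  by rewrite !mulr_ge0 ?powR_ge0 ?invr_ge0 ?exprn_ge0 ?(ltW beta_gt0) ?(ltW (scale_ratio_gt0 beta_lt1)).
have mLd : measurable_fun setT (fun y => (Lam y * d y)%:E).
  by apply/measurable_EFinP; exact: measurable_funM.
apply: (@le_trans _ _ (\int[mu]_x \int[mu]_y K E (x, y))%E).
  rewrite [leLHS]integral_mkcond; apply: ge0_le_integral => //.
  - by move=> x _; rewrite patchE; case: ifP => // _; rewrite lee_fin powR_ge0.
  - apply/(measurable_restrict _ mE measurableT); rewrite setTI; apply/measurable_EFinP.
    apply: measurable_powR_comp; apply: measurableT_comp => //.
    by apply: measurable_funS (measurable_wdiff_radius aP (adm_cont aP)).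
  - exact: (@measurable_fun_fubini_tonelli_F _ _ _ _ _ mu _ mK (K_ge0 E)).
  move=> x _; rewrite patchE; case: ifPn => xE; last by apply: integral_ge0.
  by apply: dx_le_inner; exact: set_mem xE.
rewrite (_ : (\int[mu]_x _ = \int[mu]_y \int[mu]_x K E (x, y))%E); last first.
  exact: (@fubini_tonelli _ _ _ _ _ mu mu _ mK (K_ge0 E)).
rewrite -ge0_integralZl//; last by move=> y _; rewrite lee_fin mulr_ge0.
apply: ge0_le_integral => //.
- by move=> y _; exact: integral_ge0.
- exact: (@measurable_fun_fubini_tonelli_G _ _ _ _ _ mu _ mK (K_ge0 E)).
- exact: measurable_funeM.
by move=> y _; rewrite -EFinM; exact: outer_le.
Qed.

End tonelli.

End level_sets.

(** * Bounds on the derivative *)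

Section derivative_bounds.
Context {R : realType} (beta : R).
Hypotheses (beta_gt0 : 0 < beta) (beta_lt1 : beta < 1).
Implicit Types (u Phi : R -> R) (x r s e : R).
Local Notation G := (wdiff beta).
Local Notation mu := (@lebesgue_measure R).
Local Notation rad := (radius beta).
Local Notation q := (1 / (1 - beta)).

Definition tonelli_const := (1 - beta) `^ q / beta * (2 * (scale_ratio beta) ^- 2).

Lemma tonelli_const_ge0 : 0 <= tonelli_const.
Proof.
by rewrite /tonelli_const !mulr_ge0 ?powR_ge0 ?invr_ge0 ?exprn_ge0
  ?(ltW beta_gt0) ?(ltW (scale_ratio_gt0 beta_lt1)).
Qed.

Lemma q_ge1 : 1 <= q.
Proof. by rewrite div1r invf_ge1 ?subr_gt0// gerBl ltW. Qed.

Section bounds.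
Variables (u Phi d : R -> R) (D : R).
Hypotheses (aP : admissible u Phi) (ud : var_bound u d).
Hypothesis dD : (\int[mu]_t (d t)%:E = D%:E)%E.
Hypothesis uD : forall x, 2 * u x <= D.
Local Notation B x := (ballavg Phi x (rad Phi x)).

Let q1 : 0 <= q - 1. Proof. by rewrite subr_ge0 q_ge1. Qed.

Let D0 : 0 <= D.
Proof. by have [_ d0 _] := ud; rewrite -lee_fin -dD integral_ge0// => t _; rewrite lee_fin. Qed.

Let B_le x : B x `^ (q - 1) <= (D / 2) `^ (q - 1).
Proof.
have mx := radius_maximizer beta_gt0 beta_lt1 x aP.
have B0 := maximizer_avg_gt0 beta_gt0 beta_lt1 aP mx; have [r0 _] := mx.
have [c _ E] := ballavg_mean beta_gt0 x aP r0.
apply: ge0_ler_powR; rewrite ?nnegrE ?(ltW B0) ?divr_ge0//.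
by rewrite E ler_pdivlMr// mulrC.
Qed.

(** All averages are at most [D / 2], so a constant [Lam] suffices; the result is homogeneous of
    degree [q] in [D]. *)
Lemma maximal_dx_global :
  (\int[mu]_x (`|G u x (rad Phi x)| `^ q)%:E <=
   (tonelli_const * ((D / 2) `^ (q - 1) * D))%:E)%E.
Proof.
have [md d0 _] := ud.
apply: (le_trans (@level_tonelli _ _ beta_gt0 beta_lt1 _ _ _ aP ud setT (fun=> (D / 2) `^ (q - 1)) _ _ _ _)) => //.
  by move=> _; exact: powR_ge0.
rewrite [leRHS]EFinM; apply: lee_wpmul2l; first by rewrite lee_fin tonelli_const_ge0.
under eq_integral do rewrite EFinM.
by rewrite ge0_integralZl//= ?dD// ?lee_fin ?powR_ge0//; [exact/measurable_EFinP|move=> t _; rewrite lee_fin].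
Qed.

(** Let [y] be in the level set of a center with [|x| > A]. Either [|y| > A / 2], where little of
    [d] is left, or the radius exceeds [A / 2], so that the average is at most [m / A]. [Lam] adds
    the bounds of the two cases. *)
Lemma maximal_dx_tail (m A : R) : 0 < A -> (forall x, 0 <= Phi x <= m) ->
  (\int[mu]_(x in [set x : R | (A < `|x|)%R]) (`|G u x (rad Phi x)| `^ q)%:E <=
   tonelli_const%:E * (((m / A) `^ (q - 1) * D)%:E +
     ((D / 2) `^ (q - 1))%:E * \int[mu]_(t in [set t : R | (A / 2 < `|t|)%R]) (d t)%:E))%E.
Proof.
move=> A0 Pm; have [md d0 _] := ud.
have mdE S : measurable_fun S (fun t => (d t)%:E).
  by apply/measurable_EFinP; exact: measurable_funS md.
have mE (c : R) : measurable [set t : R | c < `|t|] by exact: measurable_set_lt.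
pose Lam t := (m / A) `^ (q - 1) + (D / 2) `^ (q - 1) * \1_([set t : R | A / 2 < `|t|]) t.
have mLam : measurable_fun setT Lam.
  by apply: measurable_funD => //; apply: measurable_funM => //; exact: measurable_indic.
apply: (le_trans (@level_tonelli _ _ beta_gt0 beta_lt1 _ _ _ aP ud _ Lam (mE A) mLam _ _)).
- by move=> t; rewrite addr_ge0 ?mulr_ge0 ?powR_ge0// indicE.
- move=> x y /= Ax [xy _]; rewrite /Lam indicE.
  have [yA|Ay] := boolP (y \in _).
    rewrite mulr1; apply: (le_trans (B_le x)).
    by rewrite lerDr powR_ge0.
  rewrite mulr0 addr0.
  have mx := radius_maximizer beta_gt0 beta_lt1 x aP.
  have B0 := maximizer_avg_gt0 beta_gt0 beta_lt1 aP mx; have [r0 _] := mx.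
  have {}Ay : `|y| <= A / 2 by rewrite leNgt; apply: contra Ay => ?; exact: mem_set.
  have rA : A <= 2 * rad Phi x.
    have := ler_normD (x - y) y; rewrite subrK; lra.
  have m0 : 0 <= m by have /andP[] := Pm 0; exact: le_trans.
  have BA : B x <= m / A.
    rewrite /ballavg ler_pM ?invr_ge0 ?mulr_ge0 ?(ltW r0)//.
    + rewrite subr_ge0; apply: adm_ndecr aP _; lra.
    + have /andP[_ +] := Pm (x + rad Phi x); have /andP[+ _] := Pm (x - rad Phi x); lra.
    + by rewrite lef_pV2 ?posrE// mulr_gt0.
  by apply: ge0_ler_powR; rewrite ?nnegrE ?(ltW B0) ?divr_ge0 ?(ltW A0).
apply: lee_wpmul2l; first by rewrite lee_fin tonelli_const_ge0.
rewrite (_ : (fun y => (Lam y * d y)%:E) = (fun y => ((m / A) `^ (q - 1))%:E * (d y)%:E +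
   ((D / 2) `^ (q - 1))%:E * ((fun t => (d t)%:E) \_ [set t : R | (A / 2 < `|t|)%R]) y)%E); last first.
  apply/funext => y; rewrite /Lam mulrDl EFinD EFinM; congr (_ + _)%E.
  rewrite patchE indicE; case: ifP => _; first by rewrite mulr1 EFinM.
  by rewrite mulr0 mul0r mule0.
have pE0 y : (0 <= ((fun t => (d t)%:E) \_ [set t : R | (A / 2 < `|t|)%R]) y)%E.
  by rewrite patchE; case: ifP => _; rewrite ?lee_fin.
have mp : measurable_fun setT ((fun t => (d t)%:E) \_ [set t : R | (A / 2 < `|t|)%R]).
  by apply/(measurable_restrict _ (mE (A / 2)) measurableT).
have pc0 (c v : R) : (0 <= (c `^ v)%:E)%E by rewrite lee_fin powR_ge0.
rewrite ge0_integralD//; last 4 first.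
- by move=> t _; rewrite mule_ge0// lee_fin.
- exact: (measurable_funeM _ (mdE _)).
- by move=> t _; rewrite mule_ge0.
- exact: (measurable_funeM _ mp).
rewrite !ge0_integralZl//; last by move=> t _; rewrite lee_fin.
  by rewrite dD -EFinM -integral_mkcond.
exact: mdE.
Qed.

End bounds.

(** * Comparison with the stated constant *)

Local Notation C := (2 `^ (- 3 * beta - 2 + 4 / beta) *
               3 `^ (2 * (1 - beta) ^+ 2 / beta)).

Lemma expR1_le4 : expR 1 <= 4 :> R.
Proof.
have h : expR (1 / 2) <= 2 :> R.
  have := @expR_ge1Dx R (- (1 / 2)); rewrite expRN => h.
  rewrite -(invrK (expR _)) -[leRHS]invrK lef_pV2 ?posrE ?invr_gt0 ?expR_gt0//; lra.
have -> : expR 1 = expR (1 / 2) * expR (1 / 2) :> R.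
  by rewrite -expRD; congr expR; field.
rewrite (_ : 4 = 2 * 2 :> R); last by ring.
by apply: ler_pM => //; exact: expR_ge0.
Qed.

(** With [t = 1 / beta - 1] this is [1 + t <= e ^ t <= 4 ^ t]. *)
Lemma inv_le_pow2 : beta^-1 <= 2 `^ (2 * (beta^-1 - 1)).
Proof.
have ib : 1 <= beta^-1 by rewrite invf_ge1// ltW.
rewrite powRrM (_ : 2 `^ 2 = 4); last by rewrite powR_mulrn// expr2; ring.
apply: (@le_trans _ _ (expR 1 `^ (beta^-1 - 1))).
  rewrite -expRM mul1r; have := @expR_ge1Dx R (beta^-1 - 1).
  by rewrite addrCA subrr addr0.
by apply: ge0_ler_powR; rewrite ?nnegrE ?subr_ge0 ?expR_ge0// expR1_le4.
Qed.

(** The exponent [q - 2 / beta] changes sign at [beta = 2 / 3]. Above, the power of [1 - beta] is at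
    most 1; below, [1 / (1 - beta)] is bounded by 2 for [beta <= 1 / 2] and by 4 otherwise, so that
    only powers of 2 remain. *)
Lemma onem_pow_le : (1 - beta) `^ (q - 2 / beta) * (beta^-1 * 2 `^ (2 - q)) <=
  2 `^ ((- 3 * beta - 2 + 4 / beta) * q).
Proof.
have b1 : 0 < 1 - beta by rewrite subr_gt0.
have b1' : 1 - beta != 0 by rewrite gt_eqF.
have bN0 : beta != 0 by rewrite gt_eqF.
have ib : 1 <= beta^-1 by rewrite invf_ge1// ltW.
(* The second condition is the required inequality between exponents of 2, multiplied by
   [1 - beta]. *)
suff [c c1 c2] : exists2 c, (1 - beta) `^ (q - 2 / beta) <= 2 `^ c &
    c * (1 - beta) <= 2 * beta^-1 + 1 - 3 * beta.
  apply: (@le_trans _ _ (2 `^ c * (2 `^ (2 * (beta^-1 - 1)) * 2 `^ (2 - q)))).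
    by rewrite !ler_pM ?mulr_ge0 ?powR_ge0 ?invr_ge0 ?(ltW beta_gt0)// inv_le_pow2.
  rewrite -!powRD ?pnatr_eq0 ?implybT//; apply: ler_powR; first by rewrite ler1n.
  rewrite -subr_ge0 (_ : _ - _ = (2 * beta^-1 + 1 - 3 * beta - c * (1 - beta)) / (1 - beta)).
    by rewrite divr_ge0 ?subr_ge0// ltW.
  by field; rewrite ?bN0 ?b1'.
have [hb|hb] := lerP (2 / 3) beta.
  exists 0; last by rewrite mul0r; lra.
  rewrite powRr0; apply: (@le_trans _ _ (1 `^ (q - 2 / beta))); last by rewrite powR1.
  apply: ge0_ler_powR; rewrite ?nnegrE ?(ltW b1) ?gerBl ?(ltW beta_gt0)//.
  rewrite (_ : _ - _ = (3 * beta - 2) / (beta * (1 - beta))); last by field; rewrite ?bN0 ?b1'.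
  by rewrite divr_ge0 ?mulr_ge0 ?(ltW b1) ?(ltW beta_gt0)//; lra.
have e0 : 0 <= 2 / beta - q.
  rewrite (_ : _ - _ = (2 - 3 * beta) / (beta * (1 - beta))); last by field; rewrite ?bN0 ?b1'.
  by rewrite divr_ge0 ?mulr_ge0 ?(ltW b1) ?(ltW beta_gt0)//; lra.
have E (a : R) : (1 - beta)^-1 <= 2 `^ a ->
    (1 - beta) `^ (q - 2 / beta) <= 2 `^ (a * (2 / beta - q)).
  move=> h; rewrite -(opprB (2 / beta) q) powRN -powR_inv1 ?powR_ge0// powRAC powR_inv1 ?(ltW b1)//.
  rewrite powRrM; apply: ge0_ler_powR => //; rewrite ?nnegrE ?powR_ge0//.
  by rewrite invr_ge0 ltW.
have qE c : c * (2 / beta - q) * (1 - beta) = c * (2 * beta^-1 - 3).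
  by field; rewrite ?bN0 ?b1'.
have [hb2|hb2] := lerP beta (1 / 2).
  exists (1 * (2 / beta - q)).
    apply: E; rewrite powRr1//; rewrite -[leRHS]invrK lef_pV2 ?posrE//; lra.
  by rewrite qE; lra.
exists (2 * (2 / beta - q)).
  apply: E; rewrite powR_mulrn//.
  rewrite -[leRHS]invrK lef_pV2 ?posrE// ?invr_gt0 ?exprn_gt0//.
  have -> : (2 ^+ 2)^-1 = 1 / 4 :> R by field.
  lra.
rewrite qE; have : beta^-1 <= 2 by rewrite -[leRHS]invrK lef_pV2 ?posrE//; lra.
lra.
Qed.

(** The powers of 3 in [scale_ratio ^- 2] and in [C ^ q] coincide, which leaves powers of 2, [beta]
    and [1 - beta]. The factor [2 ^ (1 - q)] stems from [(D / 2) ^ (q - 1)]. *)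
Lemma tonelli_const_le : tonelli_const * 2 `^ (1 - q) <= C `^ q.
Proof.
have b1 : 0 < 1 - beta by rewrite subr_gt0.
have b1' : 1 - beta != 0 by rewrite gt_eqF.
have bN0 : beta != 0 by rewrite gt_eqF.
rewrite powRM ?powR_ge0// -!powRrM.
have -> : 2 * (1 - beta) ^+ 2 / beta * q = (1 - beta) * (2 / beta) by field; rewrite ?bN0 ?b1'.
have kE : (scale_ratio beta) ^- 2 = (1 - beta) `^ (- (2 / beta)) * 3 `^ ((1 - beta) * (2 / beta)).
  rewrite -powR_invn ?powR_ge0// -powRrM powRM ?powR_ge0 ?(ltW b1)// -powRrM.
  congr (_ `^ _ * _ `^ _); by field.
rewrite /tonelli_const kE [leLHS](_ : _ = (1 - beta) `^ q * (1 - beta) `^ (- (2 / beta)) *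
  (beta^-1 * (2 `^ 1 * 2 `^ (1 - q))) * 3 `^ ((1 - beta) * (2 / beta))); last first.
  by rewrite powRr1//; ring.
apply: ler_wpM2r; first exact: powR_ge0.
rewrite -!powRD ?pnatr_eq0 ?b1' ?implybT// (_ : 1 + (1 - q) = 2 - q); last by ring.
exact: onem_pow_le.
Qed.

End derivative_bounds.

(** * Smooth step functions *)

Section smooth.
Context {R : realType}.
Implicit Types (f g : R -> R) (x : R).

Definition smooth f := forall n x, derivable (derive1n n f) x 1.

Lemma smooth_coind (P : (R -> R) -> Prop) :
  (forall f, P f -> (forall x, derivable f x 1) /\ P (derive1 f)) ->
  forall f, P f -> smooth f.
Proof.
move=> H f Pf n; elim: n f Pf => [|n IH] f Pf x; first by have [] := H f Pf.
rewrite /derive1n iterSr; apply: IH; by have [] := H f Pf.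
Qed.

Lemma smooth_unfold f : smooth f -> (forall x, derivable f x 1) /\ smooth (derive1 f).
Proof.
by move=> sf; split; [exact: (sf 0%N)|move=> n x; have := sf n.+1 x; rewrite /derive1n iterSr].
Qed.

Lemma smooth_fold f : (forall x, derivable f x 1) -> smooth (derive1 f) -> smooth f.
Proof.
move=> df sf [|n] x; first exact: df.
by have := sf n x; rewrite /derive1n iterSr.
Qed.

Lemma smooth_is_derive f x : smooth f -> is_derive x 1 f (derive1 f x).
Proof. by move=> /(_ 0%N x) df; split; [exact: df|rewrite derive1E]. Qed.

Lemma is_derive_derive1 f (df : R -> R) : (forall x, is_derive x 1 f (df x)) ->
  (forall x, derivable f x 1) /\ derive1 f = df.
Proof.
by move=> H; split=> [x|]; [have [] := H x|apply/funext => x; rewrite derive1E; have [] := H x].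
Qed.

Lemma is_derive_affine f (c m a df : R) x : is_derive (m * (x - a)) 1 f df ->
  is_derive x 1 (fun y => c * f (m * (y - a))) (c * m * df).
Proof.
move=> H.
have h : is_derive x 1 (fun y => m * (y - a)) m.
  have := is_deriveZ m (is_deriveB (is_derive_id x 1) (is_derive_cst a x 1)).
  by rewrite subr0 /GRing.scale /= mulr1.
have := is_deriveZ c (@is_derive1_comp R f (fun y => m * (y - a)) x df m H h).
by rewrite /GRing.scale /= mulrCA -mulrA (mulrC m) mulrCA.
Qed.

Lemma smooth_affine f (c m a : R) : smooth f -> smooth (fun x => c * f (m * (x - a))).
Proof.
move=> sf; pose P h := exists g k, smooth g /\ h = (fun x => k * g (m * (x - a))).
apply: (@smooth_coind P); last by exists f, c.
move=> _ [g [k [sg ->]]].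
have [|d1 d2] := @is_derive_derive1 (fun x => k * g (m * (x - a)))
    (fun x => k * m * derive1 g (m * (x - a))).
  by move=> x; apply: is_derive_affine; exact: smooth_is_derive.
split; first exact: d1.
rewrite d2; exists (derive1 g), (k * m); split; last by [].
by have [] := smooth_unfold sg.
Qed.

Lemma smoothB f g : smooth f -> smooth g -> smooth (fun x => f x - g x).
Proof.
move=> sf sg; pose P h := exists f g, [/\ smooth f, smooth g & h = (fun x => f x - g x)].
apply: (@smooth_coind P); last by exists f, g.
move=> _ {sf sg}[{}f [{}g [sf sg ->]]].
have [|d1 d2] := @is_derive_derive1 (fun x => f x - g x) (fun x => derive1 f x - derive1 g x).
  by move=> x; apply: is_deriveB; exact: smooth_is_derive.
split; first exact: d1.
rewrite d2; exists (derive1 f), (derive1 g).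
by split; [have [] := smooth_unfold sf|have [] := smooth_unfold sg|].
Qed.

Let w x := (x * (1 - x))^-1.

(** Contains [exp (- 1 / (x (1 - x)))] on [(0, 1)] and is closed under derivation,
    which makes smoothness a coinductive argument. *)
Definition bump_fam (p : {poly R}) (k : nat) x :=
  if (0 < x) && (x < 1) then p.[x] * (w x ^+ k * expR (- w x)) else 0.

Let poly_bound (p : {poly R}) : exists2 M : R, 0 <= M & forall x, 0 < x < 1 -> `|p.[x]| <= M.
Proof.
have [|c cI cM] := @EVT_max R (fun x => `|p.[x]|) 0 1 ler01.
  apply: continuous_subspaceT => x; apply: (@continuous_comp _ _ _ (horner p) Num.norm).
    exact: continuous_horner.
  exact: norm_continuous.
exists `|p.[c]| => // x /andP[x0 x1]; apply: cM; by rewrite in_itv/= !ltW.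
Qed.

(** The exponential series gives [w ^ (k + 2) <= (k + 2)! * e ^ w]; the two spare powers of
    [w = 1 / (x (1 - x))] yield quadratic decay at both ends of the interval. *)
Lemma bump_fam_flat p k : exists2 M : R, 0 <= M &
  forall x, `|bump_fam p k x| <= M * x ^+ 2 /\ `|bump_fam p k x| <= M * (1 - x) ^+ 2.
Proof.
have [M M0 pM] := poly_bound p.
have MK0 : 0 <= M * (k.+2)`!%:R by rewrite mulr_ge0.
exists (M * (k.+2)`!%:R) => [//|x].
rewrite /bump_fam; case: ifPn => [x01|_]; last by rewrite normr0; split; apply: mulr_ge0 => //; exact: sqr_ge0.
have /andP[x0 x1] := x01.
have y0 : 0 < x * (1 - x) by rewrite mulr_gt0// subr_gt0.
have w0 : 0 < w x by rewrite invr_gt0.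
have key : w x ^+ k * expR (- w x) <= (k.+2)`!%:R * (x * (1 - x)) ^+ 2.
  have f0 : 0 < ((k.+2)`!%:R : R) by rewrite ltr0n fact_gt0.
  have h : w x ^+ k.+2 <= (k.+2)`!%:R * expR (w x).
    rewrite mulrC -ler_pdivrMr//; apply: le_trans (expR_ge1Dxn k.+1 (ltW w0)).
    by rewrite lerDr.
  rewrite expRN ler_pdivrMr ?expR_gt0// mulrAC -ler_pdivrMr ?exprn_gt0//.
  by rewrite -exprVn -/(w x) -exprD addn2.
have B (y : R) : 0 < y -> y <= 1 -> (x * (1 - x)) ^+ 2 <= y ^+ 2 ->
    `|p.[x] * (w x ^+ k * expR (- w x))| <= M * (k.+2)`!%:R * y ^+ 2.
  move=> y0' y1 yy; rewrite normrM -mulrA ler_pM ?pM//.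
  rewrite ger0_norm ?mulr_ge0 ?exprn_ge0 ?expR_ge0 ?(ltW w0)//.
  by apply: (le_trans key); rewrite ler_wpM2l.
split; apply: B; rewrite ?subr_gt0// ?gerBl ?(ltW x1) ?(ltW x0)//.
- by rewrite ler_pXn2r// ?nnegrE ?(ltW y0) ?(ltW x0)// ger_pMr// gerBl ltW.
- by rewrite ler_pXn2r// ?nnegrE ?(ltW y0) ?subr_ge0 ?(ltW x1)// ger_pMl ?subr_gt0// ltW.
Qed.

(** From [w' = (2 x - 1) w ^ 2]: each term of the derivative of [p w ^ k e ^ (- w)] is brought to
    the common factor [w ^ (k + 2) e ^ (- w)] by multiplying with powers of [x (1 - x) = 1 / w]. *)
Definition bump_next (p : {poly R}) (k : nat) : {poly R} :=
  p^`() * ('X * (1 - 'X)) ^+ 2 + k%:R *: (p * ('X *+ 2 - 1) * ('X * (1 - 'X))) - p * ('X *+ 2 - 1).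

Lemma bump_fam_derive p k x : is_derive x 1 (bump_fam p k) (bump_fam (bump_next p k) k.+2 x).
Proof.
have [M M0 H] := bump_fam_flat p k.
(* Handles all points outside the open interval, endpoints included: quadratic smallness forces a
   zero derivative. *)
have flat : (forall y, `|bump_fam p k y| <= M * (y - x) ^+ 2) -> is_derive x 1 (bump_fam p k) 0.
  move=> H'; apply: approx_is_derive => eta eta0.
  exists (eta / (M + 1)); first by rewrite divr_gt0// ltr_wpDl.
  have fx : bump_fam p k x = 0.
    by apply/normr0_eq0/eqP; rewrite eq_le normr_ge0 andbT (le_trans (H' x))// subrr expr0n mulr0.
  move=> y yz; rewrite fx subr0 mul0r subr0.
  apply: (le_trans (H' y)); rewrite -real_normK ?num_real// expr2 mulrA ler_wpM2r//.
  have h1 : `|y - x| * (M + 1) <= eta by rewrite -ler_pdivlMr ?ltW// ltr_wpDl.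
  by apply: le_trans h1; rewrite mulrC ler_wpM2l// lerDl.
have outM y : ~~ ((0 < y) && (y < 1)) -> bump_fam p k y = 0.
  by rewrite /bump_fam => /negbTE ->.
have [x01|x01] := boolP ((0 < x) && (x < 1)); last first.
  rewrite [X in is_derive _ _ _ X]/bump_fam (negbTE x01); apply: flat => y.
  have [y01|/outM->] := boolP ((0 < y) && (y < 1)); last first.
    by rewrite normr0 mulr_ge0 ?sqr_ge0.
  have /andP[y0 y1] := y01; have [Hy1 Hy2] := H y.
  move: x01; rewrite negb_and -!leNgt => /orP[x0|x1].
    apply: (le_trans Hy1); rewrite ler_wpM2l// ler_pXn2r// ?nnegrE; lra.
  by apply: (le_trans Hy2); rewrite ler_wpM2l// -(sqrrN (y - x)) ler_pXn2r// ?nnegrE; lra.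
have /andP[x0 x1] := x01.
have y0 : x * (1 - x) != 0 by rewrite gt_eqF// mulr_gt0// subr_gt0.
have h1 : is_derive x 1 (fun y => y * (1 - y)) (1 - 2 * x).
  rewrite (_ : (fun y => y * (1 - y)) = (fun y : R => ('X * (1 - 'X)).[y])); last by apply: funext => y; rewrite !hornerE.
  apply: (is_derive_eq (is_derive_poly ('X * (1 - 'X)) x)); rewrite derivM derivB derivX -polyC1 derivC !hornerE; ring.
have hw : is_derive x 1 w ((2 * x - 1) * w x ^+ 2).
  have [d1 d2] := h1; split; first exact: derivableV.
  rewrite deriveV// d2 /w exprVn /GRing.scale /=; ring.
have he : is_derive x 1 (fun y => expR (- w y)) (- ((2 * x - 1) * w x ^+ 2) * expR (- w x)).
  have := @is_derive1_comp R expR (fun y => - w y) x _ _ (is_derive_expR (- w x)) (is_deriveN hw).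
  by rewrite mulrC.
have hX : is_derive x 1 (fun y => w y ^+ k) (k%:R * (2 * x - 1) * w x ^+ k.+1).
  rewrite (_ : (fun y => w y ^+ k) = (fun y : R => ('X^k).[w y])); last first.
    by apply: funext => y; rewrite hornerXn.
  apply: (is_derive_eq (@is_derive1_comp R (horner 'X^k) w x _ _ (is_derive_poly 'X^k (w x)) hw)).
  rewrite derivXn hornerMn hornerXn; case: (k) => [|n]; first by rewrite mulr0n !mul0r.
  by rewrite -mulr_natl !exprS /=; ring.
have hp := is_derive_poly p x.
have hf := is_deriveM hp (is_deriveM hX he).
apply: (@near_eq_is_derive _ _ _ (fun y => p.[y] * (w y ^+ k * expR (- w y)))).
  near=> y; rewrite /bump_fam ifT//; apply/andP; split.
    by near: y; exact: lt_nbhsr.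
  by near: y; exact: lt_nbhsl.
have yE : x * (1 - x) = (w x)^-1 by rewrite invrK.
have wN0 : w x != 0 by rewrite invr_eq0.
have nE : (bump_next p k).[x] = p^`().[x] * (x * (1 - x)) ^+ 2 +
    k%:R * (p.[x] * (2 * x - 1) * (x * (1 - x))) - p.[x] * (2 * x - 1).
  rewrite /bump_next !hornerE /=; move: (p.[x]) (p^`().[x]) (k%:R : R) => P0 P1 K.
  by ring.
apply: (is_derive_eq hf); rewrite [bump_fam _ _ x]/bump_fam x01 nE yE.
rewrite (_ : ((fun y => w y ^+ k) * (fun y => expR (- w y))) x = w x ^+ k * expR (- w x))//.
rewrite !(exprS _ k.+1) !(exprS _ k) !expr2.
move: (p.[x]) (p^`().[x]) (k%:R : R) (expR (- w x)) (w x ^+ k) (w x) wN0 => P0 P1 K E V W WN0.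
by rewrite /GRing.scale /=; field.
Unshelve. all: by end_near. Qed.

Lemma bump_fam_smooth p k : smooth (bump_fam p k).
Proof.
pose P f := exists p k, f = bump_fam p k.
apply: (@smooth_coind P); last by exists p, k.
move=> _ [{}p [{}k ->]]; have [|d1 d2] := @is_derive_derive1 (bump_fam p k) (bump_fam (bump_next p k) k.+2).
  by move=> x; exact: bump_fam_derive.
by split; [exact: d1|rewrite d2; exists (bump_next p k), k.+2].
Qed.

Definition bump := bump_fam 1 0.

Lemma bump_smooth : smooth bump. Proof. exact: bump_fam_smooth. Qed.

Lemma bumpE x : bump x = if (0 < x) && (x < 1) then expR (- w x) else 0.
Proof. by rewrite /bump /bump_fam hornerC expr0 !mul1r. Qed.

Lemma bump_ge0 x : 0 <= bump x.
Proof. by rewrite bumpE; case: ifP => // _; exact: expR_ge0. Qed.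

Lemma bump_le1 x : bump x <= 1.
Proof.
rewrite bumpE; case: ifP => // /andP[x0 x1]; rewrite expR_le1 oppr_le0 invr_ge0.
by rewrite mulr_ge0 ?subr_ge0// ltW.
Qed.

Lemma bump_out x : ~~ ((0 < x) && (x < 1)) -> bump x = 0.
Proof. by rewrite bumpE => /negbTE ->. Qed.

Lemma bump_continuous : continuous bump.
Proof.
move=> x; apply/differentiable_continuous/derivable1_diffP.
by have [] := smooth_is_derive x bump_smooth.
Qed.

Local Notation mu := (@lebesgue_measure R).

(** A smooth transition from 0 to the positive constant [step 1] across [[0, 1]]. It is left
    unnormalized; the constant cancels in [lebesgue_pt_diff]. *)
Definition step x := \int[mu]_(t in `]-oo, x]) bump t.

Lemma bump_integrable (D : set R) : measurable D -> mu.-integrable D (EFin \o bump).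
Proof.
move=> mD; apply: (@integrableS _ _ _ mu setT) => //.
have : mu.-integrable setT (EFin \o (\1_`[0, 1] : R -> R)).
  apply: integrable_indic_itv.
apply: le_integrable => //.
  apply/measurable_EFinP; exact: continuous_measurable_fun bump_continuous.
move=> x _ /=; rewrite lee_fin !ger0_norm ?bump_ge0// indicE.
have [_|h] := boolP (x \in _); first exact: bump_le1.
rewrite bump_out//; apply: contra h => /andP[x0 x1].
by rewrite inE/= in_itv/= !ltW.
Qed.

Lemma step_derive x : is_derive x 1 step (bump x).
Proof.
have xx : x < x + 1 by rewrite ltrDl.
have [d1 d2] := @continuous_FTC1 R bump -oo%O x (x + 1) xx (bump_integrable (measurable_itv _))
  (ltNyr x) (@bump_continuous x).
by split; [exact: d1|rewrite -derive1E].
Qed.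

Lemma step_smooth : smooth step.
Proof.
have [d1 d2] := is_derive_derive1 step_derive.
by apply: smooth_fold => //; rewrite d2; exact: bump_smooth.
Qed.

Lemma step_le0 x : x <= 0 -> step x = 0.
Proof.
move=> x0; rewrite /step /Rintegral integral0_eq// => t; rewrite /= in_itv/= => tx.
by rewrite bump_out// negb_and -leNgt (le_trans tx).
Qed.

Lemma step_MVT x y : x < y -> exists2 c, x < c < y & step y - step x = bump c * (y - x).
Proof.
move=> xy.
have cs : {within `[x, y], continuous step}.
  apply: continuous_subspaceT => z; apply/differentiable_continuous/derivable1_diffP.
  by have [] := step_derive z.
have [c] := MVT xy (fun y _ => step_derive y) cs.
by rewrite in_itv/= => cxy E; exists c.
Qed.

Lemma step_ndecr x y : x <= y -> step x <= step y.
Proof.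
rewrite le_eqVlt => /predU1P[->//|xy]; have [c _ E] := step_MVT xy.
by rewrite -subr_ge0 E mulr_ge0 ?bump_ge0// subr_ge0 ltW.
Qed.

Lemma step_ge1 x : 1 <= x -> step x = step 1.
Proof.
rewrite le_eqVlt => /predU1P[<-//|x1]; have [c /andP[c1 cx]] := step_MVT x1.
rewrite bump_out; last by rewrite negb_and -!leNgt (ltW c1) orbT.
by rewrite mul0r => /eqP; rewrite subr_eq0 => /eqP.
Qed.

Lemma step_gt0 : 0 < step 1.
Proof.
have [c c01 E] := step_MVT (ltr01 : 0 < 1 :> R).
move: E; rewrite (step_le0 (lexx 0)) !subr0 mulr1 bumpE c01 => ->.
exact: expR_gt0.
Qed.

Lemma step_bounds x : 0 <= step x <= step 1.
Proof.
apply/andP; split.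
  have [x0|/ltW x0] := lerP x 0; first by rewrite step_le0.
  by rewrite -(step_le0 (lexx 0)) step_ndecr.
have [x1|/ltW x1] := lerP x 1; first exact: step_ndecr.
by rewrite step_ge1.
Qed.

End smooth.

(** * Continuous representatives of Sobolev functions *)

Section sobolev.
Context {R : realType}.
Implicit Types (n : nat) (a b x : R).
Local Notation mu := (@lebesgue_measure R).

Section du_bois_reymond.
Variables (f df : R -> R).
Hypothesis Wf : W11 f df.

Let fint : mu.-integrable setT (EFin \o f).
Proof. by have [/Lfun1_integrable + _ _] := Wf. Qed.

Let dfint : mu.-integrable setT (EFin \o df).
Proof. by have [_ /Lfun1_integrable + _] := Wf. Qed.

(* The factors [1] are those of [smooth_affine]. *)
Let approx (n : nat) (a b : R) x := 1 * step (n.+1%:R * (x - a)) - 1 * step (n.+1%:R * (x - b)).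

Let approx_derive n a b x : is_derive x 1 (approx n a b)
  (n.+1%:R * bump (n.+1%:R * (x - a)) - n.+1%:R * bump (n.+1%:R * (x - b))).
Proof.
have h c := @is_derive_affine R step 1 n.+1%:R c _ x (step_derive (n.+1%:R * (x - c))).
by apply: (is_derive_eq (is_deriveB (h a) (h b))); rewrite !mul1r.
Qed.

Let approx_supp n a b x : a < b -> approx n a b x != 0 -> a <= x <= b + 1.
Proof.
move=> ab; apply: contraR; rewrite negb_and -!ltNge.
have sl c : x <= c -> step (n.+1%:R * (x - c)) = 0.
  by move=> xc; rewrite step_le0// mulr_ge0_le0// subr_le0.
have sg c : 1 <= x - c -> step (n.+1%:R * (x - c)) = step 1.
  by move=> xc; rewrite step_ge1// (le_trans xc)// ler_peMl ?ler1n// (le_trans ler01).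
move=> /orP[xa|bx]; apply/eqP; rewrite /approx.
  by rewrite !sl ?subrr//; lra.
by rewrite !sg ?subrr//; lra.
Qed.

Let approx_test n a b : a < b -> test_function (approx n a b).
Proof.
move=> ab; split.
  by apply: smoothB; apply: smooth_affine; exact: step_smooth.
have cl : closed `[a, b + 1] by exact: interval_closed.
have sub : closure [set x | approx n a b x != 0] `<=` `[a, b + 1].
  have clE := (iffLR (closure_id _) cl).
  rewrite [X in _ `<=` X]clE; apply: closure_subset.
  by move=> x /= /(approx_supp ab); rewrite in_itv.
apply: subclosed_compact sub; [exact: closed_closure|exact: segment_compact].
Qed.

Let bump_scaled n a x := n.+1%:R * bump (n.+1%:R * (x - a)).

Let bump_scaled_continuous n a : continuous (bump_scaled n a).
Proof.
move=> x; apply: cvgM; first exact: cvg_cst.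
apply: (@continuous_comp _ _ _ (fun t => n.+1%:R * (t - a)) bump); last exact: bump_continuous.
by apply: cvgM; [exact: cvg_cst|apply: cvgB; [exact: cvg_id|exact: cvg_cst]].
Qed.

Let bump_scaled_bound n a x : `|bump_scaled n a x| <= n.+1%:R.
Proof.
by rewrite ger0_norm ?mulr_ge0 ?bump_ge0// ler_piMr// bump_le1.
Qed.

Let bump_scaled_out n a x : ~~ ((a < x) && (x < a + n.+1%:R^-1)) -> bump_scaled n a x = 0.
Proof.
have n0 : (0 : R) < n.+1%:R by rewrite ltr0n.
move=> h; rewrite /bump_scaled bump_out ?mulr0//; apply: contra h => /andP[h1 h2].
move: h1; rewrite pmulr_rgt0// subr_gt0 => ->/=.
by rewrite -ltrBlDl -(ltr_pM2l n0) divff// gt_eqF.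
Qed.

Let integrable_mul_bounded (D : set R) (g h : R -> R) (M : R) : measurable D ->
  mu.-integrable D (EFin \o g) -> measurable_fun D h -> (forall x, `|h x| <= M) ->
  mu.-integrable D (EFin \o (fun x => g x * h x)).
Proof.
move=> mD ig mh hM; have /integrableP[/measurable_EFinP mg _] := ig.
have M0 : 0 <= M by exact: le_trans (hM 0).
apply: (@le_integrable _ _ _ mu _ mD _ (fun x => (M%:E * (g x)%:E)%E)) => //.
- by apply/measurable_EFinP; exact: measurable_funM.
- by move=> x _ /=; rewrite lee_fin !normrM (ger0_norm M0) mulrC ler_wpM2r.
- exact: integrableZl.
Qed.

Let bump_scaled_mass n a : (\int[mu]_x (bump_scaled n a x))%R = step 1.
Proof.
have n0 : (0 : R) < n.+1%:R by rewrite ltr0n.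
have aa : a < a + n.+1%:R^-1 by rewrite ltrDl invr_gt0.
have dS x := @is_derive_affine R step 1 n.+1%:R a _ x (step_derive (n.+1%:R * (x - a))).
have cS : continuous (fun y => 1 * step (n.+1%:R * (y - a))).
  by move=> x; apply/differentiable_continuous/derivable1_diffP; have [] := dS x.
have : (\int[mu]_(x in `[a, (a + n.+1%:R^-1)%R]) (bump_scaled n a x)%:E =
    (1 * step (n.+1%:R * ((a + n.+1%:R^-1) - a)))%R%:E - (1 * step (n.+1%:R * (a - a)))%R%:E)%E.
  apply: (@continuous_FTC2 R (bump_scaled n a) (fun y => 1 * step (n.+1%:R * (y - a)))) => //.
  - by apply: continuous_subspaceT; exact: bump_scaled_continuous.
  - split; [by move=> x _; have [] := dS x| |].
      exact: cvg_at_right_filter (cS _).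
    exact: cvg_at_left_filter (cS _).
  - by move=> x _; rewrite derive1E /bump_scaled; have [_ ->] := dS x; rewrite mul1r.
rewrite subrr mulr0 (step_le0 (lexx 0)) mulr0 sube0 addrAC subrr add0r divff ?gt_eqF// mul1r => E.
rewrite /Rintegral (_ : step 1 = fine (step 1)%:E)// -E [in RHS]integral_mkcond; congr fine.
apply: eq_integral => x _; rewrite patchE; case: ifPn => // xN.
rewrite bump_scaled_out//; apply: contra xN => /andP[x1 x2].
by rewrite inE/= in_itv/= !ltW.
Qed.

(** The scaled bump has height at most [n + 1] and lives on one half of the ball of radius
    [1 / (n + 1)], so the error is at most twice the mean deviation [davg] of [f] from [f a], which
    vanishes at a Lebesgue point. *)
Let mollify_lebesgue a : lebesgue_pt f a ->
  (\int[mu]_x (f x * bump_scaled n a x))%R @[n --> \oo] --> f a * step 1.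
Proof.
move=> fa.
have cd : davg f a n.+1%:R^-1 @[n --> \oo] --> 0%:E.
  have /cvge_at_rightP/(_ (fun n => n.+1%:R^-1)) := fa; apply.
  split=> [n|]; first by rewrite invr_gt0.
  exact: cvg_harmonic.
apply/cvgrPdist_le => e e0.
have e20 : 0 < e / 2 by rewrite divr_gt0.
have /fine_cvgP[dfin /cvgrPdist_lt/(_ _ e20) dlt] := cd.
near=> n.
have n0 : (0 : R) < n.+1%:R by rewrite ltr0n.
have dn : davg f a n.+1%:R^-1 \is a fin_num by near: n.
have dle : fine (davg f a n.+1%:R^-1) < e / 2.
  have : `|0 - fine (davg f a n.+1%:R^-1)| < e / 2 by near: n.
  by rewrite sub0r normrN; apply: le_lt_trans; exact: ler_norm.
set r : R := n.+1%:R^-1 in dn dle *; have r0 : 0 < r by rewrite invr_gt0.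
have mb := continuous_measurable_fun (@bump_scaled_continuous n a).
have ib : mu.-integrable setT (EFin \o bump_scaled n a).
  apply: (@le_integrable _ _ _ mu _ measurableT _ (EFin \o (fun x => n.+1%:R * \1_`[a, a + r] x))) => //.
  - exact/measurable_EFinP.
  - move=> x _ /=; rewrite lee_fin; have [xI|xI] := boolP ((a < x) && (x < a + r)).
      rewrite indicE mem_set ?mulr1 ?[leRHS]ger0_norm ?bump_scaled_bound//.
      by move/andP: xI => [x1 x2]; rewrite /= in_itv/= !ltW.
    by rewrite bump_scaled_out// normr0.
  - under [X in mu.-integrable _ X]funext => x do rewrite /= EFinM.
    by apply: integrableZl => //; exact: integrable_indic_itv.
have ifb : mu.-integrable setT (EFin \o (fun x => f x * bump_scaled n a x)).
  by apply: (@integrable_mul_bounded _ _ _ n.+1%:R) => //; exact: bump_scaled_bound.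
have icb : mu.-integrable setT (EFin \o (fun x => f a * bump_scaled n a x)).
  under [X in mu.-integrable _ X]funext => x do rewrite /= EFinM.
  exact: integrableZl.
have -> : f a * step 1 - (\int[mu]_x (f x * bump_scaled n a x))%R =
    (\int[mu]_x (f a * bump_scaled n a x - f x * bump_scaled n a x))%R.
  by rewrite RintegralB// RintegralZl// bump_scaled_mass.
have iB : mu.-integrable setT (EFin \o (fun x => f a * bump_scaled n a x - f x * bump_scaled n a x)).
  exact: (@integrableB _ _ _ mu setT measurableT _ _ icb ifb).
apply: (le_trans (le_normr_Rintegral measurableT iB)).
rewrite -lee_fin fineK; last first.
  by apply: integrable_fin_num => //; exact: integrable_norm.
have mball : measurable (ball a r) by exact: measurable_ball.
have mfE D : measurable_fun D (fun x => `|(f x - f a)%:E|)%E.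
  have /integrableP[/measurable_EFinP mf _] := fint.
  apply: measurableT_comp => //; apply/measurable_EFinP/measurable_funB => //.
  exact: measurable_funS mf.
apply: (@le_trans _ _ (n.+1%:R%:E * \int[mu]_(y in ball a r) `|(f y - f a)%:E|)%E).
  rewrite -(@ge0_integralZl _ _ _ mu _ mball _ (mfE _) n.+1%:R%:E) ?lee_fin//.
  rewrite [leRHS]integral_mkcond; apply: ge0_le_integral => //.
  - have /integrableP[/measurable_EFinP mB _] := iB.
    by apply/measurable_EFinP; exact: (measurableT_comp _ mB).
  - by apply/(measurable_restrict _ mball measurableT)/measurable_funeM.
  move=> x _; rewrite patchE -mulrBl normrM; case: ifPn => xb.
    by rewrite lee_fin mulrC distrC ler_wpM2r// bump_scaled_bound.
  rewrite bump_scaled_out ?normr0 ?mulr0//; apply: contra xb => /andP[x1 x2].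
  by rewrite inE /ball/= ltr_norml; apply/andP; split; rewrite -/r in x2; lra.
have -> : (n.+1%:R%:E * \int[mu]_(y in ball a r) `|(f y - f a)%:E| = 2%:E * davg f a r)%E.
  rewrite /davg /iavg lebesgue_measure_ball ?(ltW r0)// inver mulrn_eq0/= gt_eqF// muleA -EFinM.
  congr (_%:E * _)%E; first by rewrite /r -mulr_natl; field.
rewrite -(fineK dn) -EFinM lee_fin; lra.
Unshelve. all: by end_near. Qed.

Let approx_bound n a b x : `|approx n a b x| <= step 1.
Proof.
rewrite /approx !mul1r.
have /andP[? ?] := step_bounds (n.+1%:R * (x - a)).
have /andP[? ?] := step_bounds (n.+1%:R * (x - b)).
by apply/ler_normlP; split; lra.
Qed.

Let measurable_approx n a b : measurable_fun setT (approx n a b).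
Proof.
apply: continuous_measurable_fun => x; apply/differentiable_continuous/derivable1_diffP.
by have [] := approx_derive n a b x.
Qed.

(** The interval is half-open because [step 0 = 0]: at [a] both terms vanish, at [b] only the second
    does. *)
Let approx_lim a b x : a < b -> approx n a b x @[n --> \oo] --> \1_`]a, b] x * step 1.
Proof.
move=> ab; apply: cvg_near_cst.
have scale (c : R) : c < x -> \forall n \near \oo, 1 <= n.+1%:R * (x - c).
  move=> cx; have xc : 0 < x - c by rewrite subr_gt0.
  near=> n; rewrite -ler_pdivrMr// (le_trans (_ : _ <= n%:R)) ?ler_nat//.
  by near: n; exact: nbhs_infty_ger.
have neg n (c : R) : x <= c -> step (n.+1%:R * (x - c)) = 0.
  by move=> xc; rewrite step_le0// mulr_ge0_le0// subr_le0.
rewrite /approx indicE.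
have [xa|ax] := lerP x a.
  rewrite memNset; last by rewrite /= in_itv/= ltNge xa.
  by near=> n; rewrite !neg// ?subrr ?mul0r// (le_trans xa)// ltW.
have [xb|bx] := lerP x b.
  rewrite mem_set; last by rewrite /= in_itv/= ax.
  near=> n; rewrite (neg n b xb) mulr0 subr0 step_ge1//.
  by near: n; exact: scale.
rewrite memNset; last by rewrite /= in_itv/= ax/= leNgt bx.
near=> n; rewrite !step_ge1 ?subrr ?mul0r//; near: n; exact: scale.
Unshelve. all: by end_near. Qed.

Let approx_cvg a b : a < b ->
  (\int[mu]_x (df x * approx n a b x))%R @[n --> \oo] -->
    (\int[mu]_(x in `]a, b]) df x)%R * step 1.
Proof.
move=> ab; have /integrableP[/measurable_EFinP mdf _] := dfint.
have [] := @dominated_convergence _ _ _ mu setT measurableT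
  (fun n x => (df x * approx n a b x)%:E) (fun x => (df x * (\1_`]a, b] x * step 1))%:E)
  (fun x => (`|df x| * step 1)%:E).
- by move=> n; apply/measurable_EFinP; exact: (measurable_funM mdf (measurable_approx n a b)).
- have mI : measurable_fun setT (\1_`]a, b] : R -> R).
    by apply: measurable_indic; exact: measurable_itv.
  apply/measurable_EFinP; exact: (measurable_funM mdf (measurable_funM mI (measurable_cst _))).
- apply: aeW => x _; apply: cvg_EFin; first by near=> n.
  by apply: cvgM; [exact: cvg_cst|exact: approx_lim].
- under [X in mu.-integrable _ X]funext => x do rewrite EFinM.
  by apply: integrableZr => //; exact: integrable_norm.
- by apply: aeW => x n _; rewrite lee_fin normrM ler_wpM2l.
move=> il _ cv.
have -> : (\int[mu]_(x in `]a, b]) df x)%R * step 1 =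
    fine (\int[mu]_x (df x * (\1_`]a, b] x * step 1))%:E).
  rewrite -RintegralZr//; last exact: integrableS dfint.
  rewrite Rintegral_mkcond; congr fine; apply: eq_integral => x _.
  rewrite patchE indicE; case: ifPn => _; first by rewrite mul1r.
  by rewrite mul0r mulr0.
apply: fine_cvg; rewrite fineK; first exact: cv.
exact: integrable_fin_num.
Unshelve. all: by end_near. Qed.

(** The weak derivative is tested against a smoothed indicator of []a, b]]. Its derivative is a
    difference of bumps at [a] and [b], which recover the values of [f] there in the limit. *)
Let lebesgue_pt_diff a b : a < b -> lebesgue_pt f a -> lebesgue_pt f b ->
  f b - f a = (\int[mu]_(x in `]a, b]) df x)%R.
Proof.
move=> ab fa fb.
have weak n : (\int[mu]_x (f x * bump_scaled n a x))%R - (\int[mu]_x (f x * bump_scaled n b x))%R =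
    - (\int[mu]_x (df x * approx n a b x))%R.
  have [_ _ [_ _ /(_ _ (approx_test n ab))]] := Wf.
  have [_ d2] := is_derive_derive1 (approx_derive n a b); rewrite d2 => E.
  have ifb c : mu.-integrable setT (EFin \o (fun x => f x * bump_scaled n c x)).
    exact: (@integrable_mul_bounded setT f (bump_scaled n c) n.+1%:R measurableT fint
      (continuous_measurable_fun (@bump_scaled_continuous n c)) (bump_scaled_bound n c)).
  rewrite -RintegralB// /Rintegral -fineN -E; congr fine; apply: eq_integral => x _.
  by rewrite mulrBr.
have h1 := cvgB (mollify_lebesgue fa) (mollify_lebesgue fb).
have h2 := cvgN (approx_cvg ab).
have : f a * step 1 - f b * step 1 = - ((\int[mu]_(x in `]a, b]) df x)%R * step 1).
  have h3 : (fun n => - (\int[mu]_x (df x * approx n a b x))%R) @ \oo -->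
      f a * step 1 - f b * step 1.
    by under eq_fun do rewrite -weak; exact: h1.
  transitivity (lim ((fun n => - (\int[mu]_x (df x * approx n a b x))%R) @ \oo)).
    by apply/esym/cvg_lim; [exact: Rhausdorff|exact: h3].
  by apply/cvg_lim; [exact: Rhausdorff|exact: h2].
rewrite -mulrBl -mulNr => /(mulIf (lt0r_neq0 step_gt0)) h; rewrite -[RHS]opprK -h; ring.
Unshelve. all: by end_near. Qed.

Definition primitive (g : R -> R) x := (\int[mu]_(t in `]-oo, x]) g t)%R.

Lemma primitiveB (g : R -> R) x y : mu.-integrable setT (EFin \o g) -> x <= y ->
  primitive g y - primitive g x = (\int[mu]_(t in `]x, y]) g t)%R.
Proof.
move=> ig xy; rewrite /primitive Rintegral_itvB ?bnd_simp//.
exact: integrableS ig.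
Qed.

(** One Lebesgue point [x0] fixes the constant, and all Lebesgue points, hence almost all points,
    are compared with it. *)
Lemma W11_representative : exists c : R,
  {ae mu, forall x, f x = c + primitive df x}.
Proof.
have [_ _ [locf _ _]] := Wf.
have aeL := lebesgue_differentiation locf.
have [x0 fx0] : exists x0, lebesgue_pt f x0.
  apply: contrapT => nL; have [N [mN N0 LN]] := aeL.
  have : (mu setT <= mu N)%E.
    apply: le_measure; rewrite ?inE//; last by move=> x _; apply: LN => /= fx; apply: nL; exists x.
  by rewrite [leRHS]N0 -set_itvNyy lebesgue_measure_itv.
exists (f x0 - primitive df x0).
apply: filterS aeL; first exact: (ae_filter_ringOfSetsType mu).
move=> x fx.
have [xx0|xx0|->] := ltgtP x x0; last by rewrite subrK.
  have := lebesgue_pt_diff xx0 fx fx0; rewrite -primitiveB ?ltW//; lra.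
have := lebesgue_pt_diff xx0 fx0 fx; rewrite -primitiveB ?ltW//; lra.
Qed.

End du_bois_reymond.

End sobolev.

(** * The profile [|v|] of the continuous representative *)

Section representative.
Context {R : realType}.
Implicit Types (f g h v : R -> R) (x y : R).
Local Notation mu := (@lebesgue_measure R).

Lemma primitive_derive g x : mu.-integrable setT (EFin \o g) ->
  {for x, continuous g} -> is_derive x 1 (primitive g) (g x).
Proof.
move=> ig cg; have xx : x < x + 1 by rewrite ltrDl.
have ig' : mu.-integrable `]-oo, x + 1] (EFin \o g) by exact: integrableS ig.
have [d1 d2] := @continuous_FTC1 R g -oo%O x (x + 1) xx ig' (ltNyr x) cg.
by split; [exact: d1|rewrite -derive1E].
Qed.

Lemma primitive_continuous g : mu.-integrable setT (EFin \o g) -> continuous (primitive g).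
Proof.
move=> ig x.
have x1 : x - 1 <= x + 1 by lra.
have ig' : mu.-integrable `[x - 1, x + 1] (EFin \o g) by exact: integrableS ig.
have c := parameterized_integral_continuous x1 ig'.
have cx : {for x, continuous (fun y => \int[mu]_(t in `[x - 1, y]) g t)%R}.
  have xI : x \in (`]x - 1, x + 1[ : interval R) by rewrite in_itv/=; apply/andP; split; lra.
  have co : {within `]x - 1, x + 1[, continuous (parameterized_integral mu (x - 1) ^~ g)}.
    by apply: continuous_subspaceW c; exact: subset_itv_oo_cc.
  move: co; rewrite continuous_open_subspace; last exact: interval_open.
  by apply; rewrite inE.
have E : \forall y \near x, primitive g (x - 1) + (\int[mu]_(t in `[(x - 1)%R, y]) g t)%R = primitive g y.
  have x1x : x - 1 < x by rewrite gtrBl ltr01.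
  near=> y.
  have xy : x - 1 <= y by apply: ltW; near: y; exact: (lt_nbhsr x1x).
  have iy : mu.-integrable `](x - 1), y] (EFin \o g) by exact: integrableS ig.
  by rewrite -Rintegral_itv_obnd_cbnd// -primitiveB// addrC subrK.
apply/cvgrPdist_lt => e e0; have /cvgrPdist_lt/(_ e e0) H := cx.
near=> y.
have Ey : primitive g (x - 1) + (\int[mu]_(t in `[(x - 1)%R, y]) g t)%R = primitive g y.
  by near: y; exact: E.
rewrite -Ey -(nbhs_singleton E) opprD addrACA subrr add0r.
by near: y; exact: H.
Unshelve. all: by end_near. Qed.

(** Collects what later arguments use of the weak derivative: through [W11_represents], increments
    of [v] are integrals of [df]. *)
Definition represents v f df :=
  [/\ continuous v, {ae mu, forall x, f x = v x} &
    forall x y, x <= y -> v y - v x = (\int[mu]_(t in `]x, y]) df t)%R].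

Lemma W11_represents f df : W11 f df -> exists v, represents v f df.
Proof.
move=> Wf; have [c fc] := W11_representative Wf.
have idf : mu.-integrable setT (EFin \o df) by have [_ /Lfun1_integrable + _] := Wf.
exists (fun x => c + primitive df x); split => //.
  by move=> x; apply: cvgD; [exact: cvg_cst|exact: primitive_continuous].
by move=> x y xy; rewrite -primitiveB//; lra.
Qed.

Lemma representsB v f df w g dg : mu.-integrable setT (EFin \o df) ->
  mu.-integrable setT (EFin \o dg) -> represents v f df -> represents w g dg ->
  represents (fun x => w x - v x) (g \- f)%R (dg \- df)%R.
Proof.
move=> idf idg [cv fv vE] [cw gw wE]; split.
- by move=> x; apply: cvgB; [exact: cw|exact: cv].
- apply: filterS2 fv gw; first exact: (ae_filter_ringOfSetsType mu).
  by move=> x /= -> ->.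
- move=> x y xy; rewrite RintegralB//; [|exact: integrableS idg|exact: integrableS idf].
  by rewrite -vE// -wE//; ring.
Qed.

Lemma represents_var_bound v f df : mu.-integrable setT (EFin \o df) ->
  represents v f df -> var_bound (fun x => `|v x|) (fun x => `|df x|).
Proof.
move=> idf [cv _ vE]; have /integrableP[/measurable_EFinP mdf _] := idf.
split => //; first exact: measurableT_comp.
move=> x y xy; apply: (@le_trans _ _ (`|v y - v x|%:E)).
  by rewrite lee_fin ler_dist_dist.
rewrite vE// EFin_normr_Rintegral//; last exact: integrableS idf.
have mS (S : set R) : measurable_fun S (EFin \o df).
  by apply/measurable_EFinP; exact: measurable_funS mdf.
apply: (le_trans (le_abse_integral mu _ (mS _))) => //.
rewrite integral_itv_obnd_cbnd//; exact: measurableT_comp.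
Qed.

Lemma represents_integral v f df (D : set R) : measurable D -> measurable_fun setT f ->
  represents v f df -> (\int[mu]_(x in D) `|v x|%:E = \int[mu]_(x in D) `|f x|%:E)%E.
Proof.
move=> mD mf [cv fv _]; have mv := continuous_measurable_fun cv.
apply: ge0_ae_eq_integral => //.
- by apply/measurable_EFinP; apply: measurableT_comp => //; exact: measurable_funS mv.
- by apply/measurable_EFinP; apply: measurableT_comp => //; exact: measurable_funS mf.
apply: filterS fv; first exact: (ae_filter_ringOfSetsType mu).
by move=> x /= ->.
Qed.

Lemma represents_integrable v f df : mu.-integrable setT (EFin \o f) ->
  represents v f df -> mu.-integrable setT (EFin \o (fun x => `|v x|)).
Proof.
move=> fi rv; have /integrableP[/measurable_EFinP mf fy] := fi.
have [cv _ _] := rv; have mv := continuous_measurable_fun cv.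
apply/integrableP; split; first by apply/measurable_EFinP; exact: measurableT_comp.
under eq_integral do rewrite /= normr_id.
by rewrite (represents_integral measurableT mf rv).
Qed.

Section profile.
Variables (f df v : R -> R).
Hypotheses (fi : mu.-integrable setT (EFin \o f)) (dfi : mu.-integrable setT (EFin \o df)).
Hypothesis rv : represents v f df.
Let u x := `|v x|.
Let Phi := primitive u.

Lemma profile_continuous : continuous u.
Proof. by move=> x; have [cv _ _] := rv; apply: continuous_comp; [exact: cv|exact: norm_continuous]. Qed.

Lemma profile_integral (D : set R) : measurable D ->
  (\int[mu]_(x in D) (u x)%:E = \int[mu]_(x in D) `|f x|%:E)%E.
Proof.
by move=> mD; apply: represents_integral rv => //; have /integrableP[/measurable_EFinP mf _] := fi.
Qed.

Lemma profile_sup x : ((2 * u x)%:E <= \int[mu]_t `|df t|%:E)%E.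
Proof.
exact: (level_sup_bound x (fun t => normr_ge0 (v t)) (represents_var_bound dfi rv) (represents_integrable fi rv)).
Qed.

Lemma profile_mass x : 0 <= Phi x <= fine (\int[mu]_t `|f t|%:E)%E.
Proof.
have iu := represents_integrable fi rv.
apply/andP; split; first by apply: Rintegral_ge0 => t _; exact: normr_ge0.
rewrite -profile_integral// fine_le//.
- by apply: integrable_fin_num => //; exact: integrableS iu.
- exact: integrable_fin_num.
apply: ge0_subset_integral => //; first by have /integrableP[] := iu.
by move=> t _; rewrite lee_fin; exact: normr_ge0.
Qed.

Lemma profile_admissible : (exists a b, Phi a < Phi b) -> admissible u Phi.
Proof.
move=> neq; split => //.
- move=> x; apply: primitive_derive; first exact: represents_integrable rv.
  exact: profile_continuous.
- exact: profile_continuous.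
- by move=> x; rewrite normr_ge0.
- have idf : (\int[mu]_t `|df t|%:E)%E \is a fin_num.
    by apply: integrable_fin_num => //; exact: integrable_norm.
  exists (fine (\int[mu]_t `|df t|%:E)%E) => x.
  rewrite -lee_fin fineK//; apply: le_trans (profile_sup x).
  by rewrite lee_fin; have := normr_ge0 (v x); rewrite /u; lra.
- by exists (fine (\int[mu]_t `|f t|%:E)%E); exact: profile_mass.
Qed.

Lemma iavg_profile (beta : R) x r : 0 < beta -> 0 < r ->
  ((r `^ beta)%:E * iavg f (ball x r) = (wdiff beta Phi x r)%:E)%E.
Proof.
move=> b0 r0; have iu := represents_integrable fi rv.
have xr : x - r <= x + r by lra.
rewrite /wdiff primitiveB// /iavg lebesgue_measure_ball ?ltW//.
rewrite inver mulrn_eq0/= gt_eqF//.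
have -> : (\int[mu]_(y in ball x r) `|(f y)%:E| = (\int[mu]_(t in `](x - r), (x + r)]) u t)%:E)%E.
  rewrite /Rintegral fineK; last by apply: integrable_fin_num => //; exact: integrableS iu.
  rewrite -(profile_integral (measurable_ball x r)) ball_itv.
  rewrite [RHS]integral_itv_bndoo//.
  by have /integrableP[m _] := iu; exact: measurable_funS m.
rewrite -!EFinM -(powR_B1 b0 r0).
congr EFin; rewrite -mulr_natr; field.
by rewrite gt_eqF.
Qed.

Lemma frac_maximal_profile (beta : R) x : 0 < beta -> beta < 1 -> admissible u Phi ->
  frac_maximal beta f x = (fracmax beta Phi x)%:E.
Proof.
move=> b0 b1 aP; have [r0 mr] := radius_maximizer b0 b1 x aP.
apply/eqP; rewrite eq_le; apply/andP; split.
  apply: ub_ereal_sup => _ [r + <-]; rewrite /= in_itv/= andbT le_eqVlt => /predU1P[<-|rgt0].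
    rewrite powR0 ?gt_eqF// mul0e lee_fin; apply: (le_trans (wdiff_ge0 beta x aP r0)).
    by rewrite /fracmax.
  by rewrite iavg_profile// lee_fin (fracmax_ge b0 b1 _ aP).
apply: ereal_sup_ubound; exists (radius beta Phi x); first by rewrite /= in_itv/= andbT ltW.
by rewrite iavg_profile.
Qed.

Lemma frac_maximal_profile0 (beta : R) x : 0 < beta ->
  ~ (exists a b, Phi a < Phi b) -> frac_maximal beta f x = 0%E.
Proof.
move=> b0 nPhi.
have Pab a b : a <= b -> Phi b - Phi a = 0.
  move=> ab; apply/eqP; rewrite eq_le; apply/andP; split.
    by rewrite leNgt subr_gt0; apply/negP => h; apply: nPhi; exists a, b.
  rewrite primitiveB//; last exact: represents_integrable rv.
  by apply: Rintegral_ge0 => t _; exact: normr_ge0.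
apply/eqP; rewrite eq_le; apply/andP; split.
  apply: ub_ereal_sup => _ [r + <-]; rewrite /= in_itv/= andbT le_eqVlt => /predU1P[<-|rgt0].
    by rewrite powR0 ?gt_eqF// mul0e.
  by rewrite iavg_profile// /wdiff Pab ?mulr0//; lra.
apply: ereal_sup_ubound; exists 0; first by rewrite /= in_itv/= lexx.
by rewrite powR0 ?gt_eqF// mul0e.
Qed.

End profile.

(** The norm of [dg - df] controls the sup norm of [w - v], by [profile_sup] for the difference; the
    norm of [g - f] controls the primitives. *)
Lemma profile_close f df v g dg w (e : R) :
  mu.-integrable setT (EFin \o f) -> mu.-integrable setT (EFin \o df) ->
  mu.-integrable setT (EFin \o g) -> mu.-integrable setT (EFin \o dg) ->
  represents v f df -> represents w g dg ->
  (W11_norm (g \- f)%R (dg \- df)%R <= e%:E)%E ->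
  close_by e (fun x => `|v x|) (primitive (fun x => `|v x|))
             (fun x => `|w x|) (primitive (fun x => `|w x|)).
Proof.
move=> fi dfi gi dgi rv rw; rewrite /W11_norm !Lnorm1 => We.
have rB := representsB dfi dgi rv rw.
have iB : mu.-integrable setT (EFin \o (g \- f)%R).
  exact: (@integrableB _ _ _ mu setT measurableT _ _ gi fi).
have idB : mu.-integrable setT (EFin \o (dg \- df)%R).
  exact: (@integrableB _ _ _ mu setT measurableT _ _ dgi dfi).
have n0 h : (0 <= \int[mu]_x `|(EFin \o h) x|)%E by exact: integral_ge0.
have h1 : (\int[mu]_x `|(EFin \o (g \- f)%R) x| <= e%:E)%E.
  by apply: le_trans We; rewrite leeDl.
have h2 : (\int[mu]_x `|(EFin \o (dg \- df)%R) x| <= e%:E)%E.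
  by apply: le_trans We; rewrite leeDr.
have cl1 x : `|w x - v x| <= e.
  have := le_trans (profile_sup iB idB rB x) h2; rewrite lee_fin.
  have := normr_ge0 (w x - v x); lra.
have iv := represents_integrable fi rv; have iw := represents_integrable gi rw.
move=> t; split; first by rewrite (le_trans (ler_dist_dist _ _))// distrC.
have ivt : mu.-integrable `]-oo, t] (EFin \o (fun x => `|v x|)) by exact: integrableS iv.
have iwt : mu.-integrable `]-oo, t] (EFin \o (fun x => `|w x|)) by exact: integrableS iw.
rewrite /primitive -RintegralB//.
have iBt : mu.-integrable `]-oo, t] (EFin \o (fun x => `|v x| - `|w x|)).
  exact: (@integrableB _ _ _ mu _ (measurable_itv _) _ _ ivt iwt).
apply: le_trans; first by apply: le_normr_Rintegral.
have /integrableP[mvw _] := iBt.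
rewrite -lee_fin fineK; last first.
  by apply: integrable_fin_num => //; exact: integrable_norm.
apply: le_trans h1.
have := represents_integral measurableT _ rB; rewrite /= => <-; last first.
  by have /integrableP[/measurable_EFinP] := iB.
have iwv := represents_integrable iB rB.
apply: (@le_trans _ _ (\int[mu]_(x in `]-oo, t]) `|w x - v x|%:E)%E).
  apply: ge0_le_integral => //.
  - by have /measurable_EFinP := mvw => h; apply/measurable_EFinP; exact: (measurableT_comp _ h).
  - by have /integrableP[h _] := iwv; exact: measurable_funS h.
  - by move=> x _; rewrite lee_fin distrC ler_dist_dist.
apply: ge0_subset_integral => //; first by have /integrableP[h _] := iwv.
Qed.

End representative.

(** * The derivative of the maximal function *)

Section maximal_derivative.
Context {R : realType} (beta : R).
Hypotheses (beta_gt0 : 0 < beta) (beta_lt1 : beta < 1).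
Local Notation mu := (@lebesgue_measure R).
Local Notation q := (1 / (1 - beta)).
Local Notation C := (2 `^ (- 3 * beta - 2 + 4 / beta) *
               3 `^ (2 * (1 - beta) ^+ 2 / beta)).

(** A measurable, everywhere defined stand-in for the derivative of the maximal function, with which
    it agrees off a countable set when [v] is not zero. *)
Definition maximal_dx (v : R -> R) x :=
  wdiff beta (fun t => `|v t|) x (radius beta (primitive (fun t => `|v t|)) x).

Local Notation adm v := (admissible (fun t => `|v t|) (primitive (fun t => `|v t|))).

Let q_gt0 : 0 < q. Proof. by rewrite div1r invr_gt0 subr_gt0. Qed.

(** Every subset of a countable set is measurable, so the values on [N] are harmless. *)
Lemma measurable_off_countable (g h : R -> R) (N : set R) : countable N ->
  measurable_fun setT h -> (forall x, ~ N x -> g x = h x) -> measurable_fun setT g.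
Proof.
move=> cN mh gh _ Y mY; rewrite setTI.
have -> : g @^-1` Y = (h @^-1` Y `\` N) `|` (g @^-1` Y `&` N).
  apply/seteqP; split => x /=.
    by move=> Yx; have [Nx|nNx] := pselect (N x); [right|left; split; rewrite -?gh].
  by move=> [[Yx nNx]|[]//]; rewrite gh.
apply: measurableU.
  apply: measurableD; last exact: countable_measurable.
  by rewrite -[X in measurable X]setTI; exact: mh.
apply: countable_measurable => //; apply: (sub_countable _ cN).
by apply: subset_card_le; exact: subIsetr.
Qed.

Lemma ae_off_countable (N : set R) (P : R -> Prop) : countable N ->
  (forall x, ~ N x -> P x) -> {ae mu, forall x, P x}.
Proof.
move=> cN NP; exists N; split; first exact: countable_measurable.
  exact: countable_lebesgue_measure0.
by move=> x /= nP; apply: contrapT => /NP.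
Qed.

Section one_function.
Variables (f df v : R -> R).
Hypotheses (Wf : W11 f df) (rv : represents v f df).
Let u x := `|v x|.
Let Phi := primitive u.

Let fi : mu.-integrable setT (EFin \o f).
Proof. by have [/Lfun1_integrable + _ _] := Wf. Qed.

Let dfi : mu.-integrable setT (EFin \o df).
Proof. by have [_ /Lfun1_integrable + _] := Wf. Qed.

Lemma maximal_deriv_off_exceptional x : adm v -> ~ exceptional beta u Phi x ->
  ediff_at (frac_maximal beta f) x /\ frac_maximal_deriv beta f x = maximal_dx v x.
Proof.
move=> aP nx.
have FE : fine \o frac_maximal beta f = fracmax beta Phi.
  by apply/funext => y; rewrite /= (frac_maximal_profile fi rv).
have dF := fracmax_is_derive beta_gt0 beta_lt1 aP nx (radius_maximizer beta_gt0 beta_lt1 x aP).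
split; last by rewrite /frac_maximal_deriv FE derive1E; have [_ ->] := dF.
split; last by rewrite FE; have [] := dF.
by near=> y; rewrite (frac_maximal_profile fi rv).
Unshelve. all: by end_near. Qed.

Lemma maximal_deriv_zero : ~ adm v ->
  (forall x, ediff_at (frac_maximal beta f) x) /\ frac_maximal_deriv beta f = cst 0.
Proof.
move=> nadm.
have nPhi : ~ exists a b, Phi a < Phi b.
  by move=> h; apply: nadm; exact: (profile_admissible fi dfi rv).
have FE : fine \o frac_maximal beta f = cst 0.
  by apply/funext => y; rewrite /= (frac_maximal_profile0 fi rv).
split=> [x|].
  split; last by rewrite FE; exact: derivable_cst.
  by near=> y; rewrite (frac_maximal_profile0 fi rv).
by rewrite /frac_maximal_deriv FE; apply/funext => x; rewrite derive1_cst.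
Unshelve. all: by end_near. Qed.

Lemma measurable_maximal_dx : adm v -> measurable_fun setT (maximal_dx v).
Proof. by move=> aP; apply: (measurable_wdiff_radius beta_gt0 beta_lt1 aP); exact: adm_cont aP. Qed.

Lemma maximal_deriv_ae : exists N : set R, [/\ countable N,
    forall x, ~ N x -> ediff_at (frac_maximal beta f) x &
    adm v -> forall x, ~ N x -> frac_maximal_deriv beta f x = maximal_dx v x].
Proof.
have [aP|nadm] := pselect (adm v).
  exists (exceptional beta u Phi); split.
  - exact: countable_exceptional.
  - by move=> x nx; have [] := maximal_deriv_off_exceptional aP nx.
  - by move=> _ x nx; have [] := maximal_deriv_off_exceptional aP nx.
have [h _] := maximal_deriv_zero nadm.
by exists set0; split => //; exact: countable0.
Qed.

Lemma measurable_maximal_deriv : measurable_fun setT (frac_maximal_deriv beta f).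
Proof.
have [aP|nadm] := pselect (adm v); last first.
  by have [_ ->] := maximal_deriv_zero nadm; exact: measurable_cst.
have [N [cN _ H]] := maximal_deriv_ae.
by apply: (measurable_off_countable cN (measurable_maximal_dx aP)); exact: H.
Qed.

(** Stated for any [d] that bounds the variation: [|df|] gives the theorem's inequality, [|dg - df|]
    gives continuity at zero. *)
Lemma maximal_deriv_norm (d : R -> R) (D : R) : var_bound u d ->
  (\int[mu]_t (d t)%:E = D%:E)%E ->
  ('N[mu]_(q%:E)[EFin \o frac_maximal_deriv beta f] <= (C * D)%:E)%E.
Proof.
move=> ud dD.
have D0 : 0 <= D.
  by have [_ d0 _] := ud; rewrite -lee_fin -dD integral_ge0// => t _; rewrite lee_fin.
have C0 : 0 <= C by rewrite mulr_ge0 ?powR_ge0.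
have [aP|nadm] := pselect (adm v); last first.
  have [_ ->] := maximal_deriv_zero nadm.
  rewrite (_ : EFin \o cst 0 = cst 0%E)// Lnorm0 ?lee_fin ?mulr_ge0//.
  by rewrite eqe gt_eqF.
have [N [cN _ H]] := maximal_deriv_ae.
have -> : ('N[mu]_(q%:E)[EFin \o frac_maximal_deriv beta f] =
    (\int[mu]_x (`|maximal_dx v x| `^ q)%:E) `^ q^-1)%E.
  rewrite unlock; congr (_ `^ _)%E.
  apply: ge0_ae_eq_integral => //.
  - apply/measurable_EFinP; apply: measurable_powR_comp; apply: measurableT_comp => //.
    exact: measurable_maximal_deriv.
  - apply/measurable_EFinP; apply: measurable_powR_comp; apply: measurableT_comp => //.
    exact: measurable_maximal_dx.
  - by move=> x _; rewrite lee_fin powR_ge0.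
  - by apply: (ae_off_countable cN) => x nx _; rewrite /= H.
have uD x : 2 * u x <= D.
  rewrite -lee_fin -dD; apply: level_sup_bound => //; last exact: represents_integrable rv.
  by move=> t; exact: normr_ge0.
have := @maximal_dx_global _ _ beta_gt0 beta_lt1 _ _ _ _ aP ud dD uD.
set I := (\int[mu]_x _)%E => IK.
(* Uses [(D / 2) ^ (q - 1) * D = 2 ^ (1 - q) * D ^ q]. *)
have K1 : tonelli_const beta * ((D / 2) `^ (q - 1) * D) <= (C * D) `^ q.
  have -> : (D / 2) `^ (q - 1) * D = 2 `^ (1 - q) * D `^ q.
    rewrite powRM// ?invr_ge0// -mulrA mulrCA [_ `^ (q - 1) * D]mulrC mulr_powRB1//.
    rewrite -powR_inv1// -powRrM; congr (_ `^ _ * _); ring.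
  rewrite powRM// mulrA; apply: ler_wpM2r; first exact: powR_ge0.
  exact: tonelli_const_le.
have I0 : (0 <= I)%E by apply: integral_ge0 => x _; rewrite lee_fin powR_ge0.
have q0 : 0 <= q^-1 by rewrite invr_ge0 ltW.
apply: (@le_trans _ _ ((((C * D) `^ q)%:E) `^ q^-1)%E).
  apply: gt0_ler_poweR => //.
  - by rewrite in_itv/= I0 leey.
  - by rewrite in_itv/= lee_fin powR_ge0 leey.
  - by apply: le_trans IK _; rewrite lee_fin.
by rewrite poweR_EFin -powRrM mulfV ?gt_eqF// powRr1 ?mulr_ge0.
Qed.

End one_function.

Lemma maximal_deriv_bound (f df : R -> R) : W11 f df ->
  [/\ {ae mu, forall x, ediff_at (frac_maximal beta f) x},
      frac_maximal_deriv beta f \in Lfun mu q%:E &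
      ('N[mu]_(q%:E)[EFin \o frac_maximal_deriv beta f] <=
        C%:E * 'N[mu]_1[EFin \o df])%E].
Proof.
move=> Wf; have [v rv] := W11_represents Wf.
have [_ /Lfun1_integrable dfi _] := Wf.
have dD : (\int[mu]_t `|df t|%:E = (fine (\int[mu]_t `|df t|%:E))%:E)%E.
  by rewrite fineK//; apply: integrable_fin_num => //; exact: integrable_norm.
have N := maximal_deriv_norm Wf rv (represents_var_bound dfi rv) dD.
split.
- by have [S [cS + _]] := maximal_deriv_ae Wf rv; exact: ae_off_countable.
- rewrite inE; apply/andP; split; rewrite inE/=; first exact: measurable_maximal_deriv Wf rv.
  by apply: le_lt_trans N _; rewrite ltry.
- by apply: (le_trans N); rewrite Lnorm1 EFinM -dD.
Qed.

End maximal_derivative.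

(** * Tails of integrable functions *)

Section tails.
Context {R : realType}.
Local Notation mu := (@lebesgue_measure R).

Lemma integral_abs_close (f g : R -> R) (S : set R) (e : R) : measurable S ->
  mu.-integrable setT (EFin \o f) -> mu.-integrable setT (EFin \o g) ->
  (\int[mu]_x `|(g x - f x)%:E| <= e%:E)%E ->
  (\int[mu]_(x in S) `|(g x)%:E| <= \int[mu]_(x in S) `|(f x)%:E| + e%:E)%E.
Proof.
move=> mS /integrableP[/measurable_EFinP mf _] /integrableP[/measurable_EFinP mg _] fg.
have mfS : measurable_fun S (fun x => `|(f x)%:E|%E).
  by apply: measurableT_comp => //; apply/measurable_EFinP; exact: measurable_funS mf.
have mgS : measurable_fun S (fun x => `|(g x)%:E|%E).
  by apply: measurableT_comp => //; apply/measurable_EFinP; exact: measurable_funS mg.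
have mB : measurable_fun setT (fun x => `|(g x - f x)%:E|%E).
  by apply: measurableT_comp => //; apply/measurable_EFinP; exact: measurable_funB.
have mBS : measurable_fun S (fun x => `|(g x - f x)%:E|%E) by exact: measurable_funS mB.
apply: (@le_trans _ _ (\int[mu]_(x in S) (`|(f x)%:E| + `|(g x - f x)%:E|))%E).
  apply: ge0_le_integral => //; first exact: emeasurable_funD.
  move=> x _; rewrite -EFinD lee_fin.
  by have := ler_normD (f x) (g x - f x); rewrite addrC subrK addrC.
rewrite ge0_integralD// leeD2l//; apply: le_trans fg.
exact: ge0_subset_integral.
Qed.

Lemma integral_tail_vanish (f : R -> R) (t : R) : mu.-integrable setT (EFin \o f) -> 0 < t ->
  exists2 B, 0 < B & forall A, B <= A ->
    (\int[mu]_(x in [set x : R | (A < `|x|)%R]) `|(f x)%:E| <= t%:E)%E.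
Proof.
move=> fi t0; have /integrableP[/measurable_EFinP mf _] := fi.
have mT (A : R) : measurable [set x : R | A < `|x|] by exact: measurable_set_lt.
have mabs : measurable_fun setT (fun x => `|(f x)%:E|%E).
  by apply: measurableT_comp => //; exact/measurable_EFinP.
pose h n x := ((fun x => `|(f x)%:E|%E) \_ [set x : R | n.+1%:R < `|x|]) x.
have [] := @dominated_convergence _ _ _ mu setT measurableT h (cst 0%E) (fun x => `|(f x)%:E|%E).
- by move=> n; apply/(measurable_restrict _ (mT _) measurableT); exact: measurable_funS mabs.
- exact: measurable_cst.
- apply: aeW => x _; apply: cvg_near_cst; near=> n.
  rewrite /h patchE memNset//=; apply/negP; rewrite -leNgt.
  rewrite (@le_trans _ _ n%:R) ?ler_nat//; near: n; exact: nbhs_infty_ger.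
- exact: integrable_norm.
- by apply: aeW => x n _; rewrite /h patchE; case: ifP => _; rewrite ?abse_id// abse0.
move=> _ _; rewrite integral_cst// mul0e => /fine_cvgP[+ /cvgrPdist_lt/(_ _ t0)].
move=> fin cv; have [n [finn cvn]] : exists n, (\int[mu]_x h n x)%E \is a fin_num /\
    `|0 - fine (\int[mu]_x h n x)%E| < t.
  have : \forall n \near \oo, (\int[mu]_x h n x)%E \is a fin_num /\
    `|0 - fine (\int[mu]_x h n x)%E| < t by apply: filterS2 fin cv.
  by move=> [n _ /(_ n (leqnn n))]; exists n.
exists n.+1%:R; first by rewrite ltr0n.
move=> A nA; apply: (@le_trans _ _ (\int[mu]_x h n x)%E).
  rewrite /h -integral_mkcond; apply: (ge0_subset_integral mu (mT _) (mT _)) => //.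
    exact: measurable_funS mabs.
  by move=> x /=; exact: le_lt_trans.
rewrite -(fineK finn) lee_fin; move: cvn; rewrite sub0r normrN => h1.
by rewrite ltW// (le_lt_trans _ h1)// ler_norm.
Unshelve. all: by end_near. Qed.

End tails.

(** * Continuity *)

Section continuity.
Context {R : realType} (beta : R).
Hypotheses (beta_gt0 : 0 < beta) (beta_lt1 : beta < 1).
Local Notation mu := (@lebesgue_measure R).
Local Notation q := (1 / (1 - beta)).
Local Notation C := (2 `^ (- 3 * beta - 2 + 4 / beta) *
               3 `^ (2 * (1 - beta) ^+ 2 / beta)).
Local Notation adm v := (admissible (fun t => `|v t|) (primitive (fun t => `|v t|))).

Let q_gt0 : 0 < q. Proof. by rewrite div1r invr_gt0 subr_gt0. Qed.
Let q1_gt0 : 0 < q - 1.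
Proof. by rewrite subr_gt0 div1r invf_gt1 ?subr_gt0// gtrBl. Qed.

Let W11i (f df : R -> R) : W11 f df ->
  mu.-integrable setT (EFin \o f) /\ mu.-integrable setT (EFin \o df).
Proof. by move=> [/Lfun1_integrable ? /Lfun1_integrable ? _]. Qed.

Let W11_norm_le (f df g dg : R -> R) (e : R) : (W11_norm (g \- f)%R (dg \- df)%R <= e%:E)%E ->
  (\int[mu]_x `|(g x - f x)%:E| <= e%:E)%E /\ (\int[mu]_x `|(dg x - df x)%:E| <= e%:E)%E.
Proof.
rewrite /W11_norm !Lnorm1 => We.
have n0 h : (0 <= \int[mu]_x `|(EFin \o h) x|)%E by exact: integral_ge0.
by split; apply: le_trans We; [rewrite leeDl|rewrite leeDr].
Qed.

(** [maximal_dx_tail] is applied to [g], with mass and variation bounded by [m + 1] and [D + 1], so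
    that [A] and [e] depend on [f] only. *)
Lemma maximal_tail_small (f df v : R -> R) (eta : R) : W11 f df -> represents v f df ->
  0 < eta -> exists A e, [/\ 0 < A, 0 < e & forall g dg w, W11 g dg -> represents w g dg ->
    adm w -> (W11_norm (g \- f)%R (dg \- df)%R <= e%:E)%E ->
    (\int[mu]_(x in [set x : R | (A < `|x|)%R]) (`|maximal_dx beta w x| `^ q)%:E <= eta%:E)%E].
Proof.
move=> Wf rv eta0; have [fi dfi] := W11i Wf.
pose D := fine (\int[mu]_t `|(df t)%:E|)%E; pose m := fine (\int[mu]_t `|(f t)%:E|)%E.
have mE : (\int[mu]_t `|(f t)%:E| = m%:E)%E.
  by rewrite fineK//; apply: integrable_fin_num => //; exact: integrable_norm.
have DE : (\int[mu]_t `|(df t)%:E| = D%:E)%E.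
  by rewrite fineK//; apply: integrable_fin_num => //; exact: integrable_norm.
have m0 : 0 <= m by rewrite fine_ge0// integral_ge0.
have D0 : 0 <= D by rewrite fine_ge0// integral_ge0.
clearbody m D.
pose K := tonelli_const beta; have K0 : 0 <= K := tonelli_const_ge0 beta_gt0 beta_lt1.
pose L := ((D + 1) / 2) `^ (q - 1); have L0 : 0 <= L by exact: powR_ge0.
(* [a0] and [t0] make each of the two terms of the tail bound at most [eta / (2 * (K + 1))]; [t0] is
   halved since the tail of [dg] is that of [df] plus an error [t0]. *)
pose a0 := eta / (2 * (K + 1) * (D + 1)).
have a00 : 0 < a0 by rewrite divr_gt0// !mulr_gt0// ltr_wpDl.
pose t0 := eta / (2 * (K + 1) * (L + 1)) / 2.
have t00 : 0 < t0 by rewrite !divr_gt0// !mulr_gt0// ltr_wpDl.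
have [B B0 HB] := integral_tail_vanish dfi t00.
pose A := Num.max (2 * B) ((m + 1) / (a0 `^ (q - 1)^-1)).
have A0 : 0 < A by rewrite lt_max mulr_gt0.
have BA : B <= A / 2 by rewrite ler_pdivlMr// mulrC le_max lexx.
have mA : ((m + 1) / A) `^ (q - 1) <= a0.
  have a0E : (a0 `^ (q - 1)^-1) `^ (q - 1) = a0.
    by rewrite -powRrM mulVf ?lt0r_neq0// powRr1// ltW.
  rewrite -[leRHS]a0E.
  apply: ge0_ler_powR; rewrite ?nnegrE ?powR_ge0 ?(ltW q1_gt0)//.
    by rewrite divr_ge0 ?addr_ge0 ?(ltW A0).
  rewrite ler_pdivrMr// mulrC -ler_pdivrMr ?powR_gt0//.
  by rewrite le_max lexx orbT.
exists A, (Num.min 1 t0); split => //; first by rewrite lt_min ltr01.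
move=> g dg w Wg rw aw We; have [gi dgi] := W11i Wg.
have [h1 h2] := W11_norm_le We.
pose Dg := fine (\int[mu]_t `|(dg t)%:E|)%E.
have DgE : (\int[mu]_t `|(dg t)%:E| = Dg%:E)%E.
  by rewrite fineK//; apply: integrable_fin_num => //; exact: integrable_norm.
have Dg0 : 0 <= Dg by rewrite fine_ge0// integral_ge0.
have DgD : Dg <= D + 1.
  rewrite -lee_fin -DgE EFinD -DE; apply: integral_abs_close => //.
  by apply: (le_trans h2); rewrite lee_fin ge_min lexx.
have tailg : (\int[mu]_(t in [set t : R | (A / 2 < `|t|)%R]) `|(dg t)%:E| <= (t0 + t0)%:E)%E.
  apply: (@le_trans _ _ (\int[mu]_(t in [set t : R | (A / 2 < `|t|)%R]) `|(df t)%:E| + t0%:E)%E).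
    apply: integral_abs_close => //; first exact: measurable_set_lt.
    by apply: (le_trans h2); rewrite lee_fin ge_min lexx orbT.
  by rewrite EFinD leeD2r// HB.
have massg x : 0 <= primitive (fun t => `|w t|) x <= m + 1.
  have /andP[-> /le_trans] := profile_mass gi rw x; apply.
  rewrite -lee_fin fineK; last by apply: integrable_fin_num => //; exact: integrable_norm.
  rewrite EFinD -mE; apply: integral_abs_close => //.
  by apply: (le_trans h1); rewrite lee_fin ge_min lexx.
have uD x : 2 * `|w x| <= Dg by rewrite -lee_fin -DgE; exact: (profile_sup gi dgi rw).
apply: (le_trans (maximal_dx_tail beta_gt0 beta_lt1 aw (represents_var_bound dgi rw) DgE uD A0 massg)).
apply: (@le_trans _ _ (K%:E * ((a0 * (D + 1))%:E + L%:E * (t0 + t0)%:E))%E).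
  apply: lee_wpmul2l; first by rewrite lee_fin.
  apply: leeD; first by rewrite lee_fin ler_pM// powR_ge0.
  apply: (@le_trans _ _ (L%:E * \int[mu]_(t in [set t : R | (A / 2 < `|t|)%R]) `|(dg t)%:E|)%E).
    apply: lee_wpmul2r; first exact: integral_ge0.
    rewrite lee_fin; apply: ge0_ler_powR; rewrite ?nnegrE ?(ltW q1_gt0) ?divr_ge0 ?addr_ge0//.
    by rewrite ler_wpM2r.
  by apply: lee_wpmul2l; rewrite ?lee_fin.
rewrite -!EFinM lee_fin.
have K1 : 0 < K + 1 by rewrite ltr_wpDl.
have L1 : 0 < L + 1 by rewrite ltr_wpDl.
have D1 : 0 < D + 1 by rewrite ltr_wpDl.
have -> : a0 * (D + 1) = eta / (2 * (K + 1)) by rewrite /a0; field; rewrite !gt_eqF.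
have Lt : L * (t0 + t0) <= eta / (2 * (K + 1)).
  rewrite (_ : t0 + t0 = eta / (2 * (K + 1)) / (L + 1)); last by rewrite /t0; field; rewrite !gt_eqF.
  rewrite mulrCA ler_piMr ?divr_ge0 ?mulr_ge0 ?(ltW eta0) ?(ltW K1)//.
  by rewrite ler_pdivrMr// mul1r lerDl.
apply: (@le_trans _ _ (K * (eta / (2 * (K + 1)) + eta / (2 * (K + 1))))).
  by rewrite ler_wpM2l// lerD2l.
rewrite (_ : _ + _ = eta / (K + 1)); last by field; rewrite gt_eqF.
by rewrite mulrCA ler_piMr ?(ltW eta0)// ler_pdivrMr// mul1r lerDl.
Qed.

Lemma profile_zero (f df v : R -> R) : W11 f df -> represents v f df -> ~ adm v ->
  forall x, v x = 0.
Proof.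
move=> Wf rv nadm x; have [fi dfi] := W11i Wf.
have nPhi : ~ exists a b, primitive (fun t => `|v t|) a < primitive (fun t => `|v t|) b.
  by move=> h; apply: nadm; exact: (profile_admissible fi dfi rv).
have PE : primitive (fun t => `|v t|) = cst (primitive (fun t => `|v t|) 0).
  apply/funext => y /=; apply/eqP; rewrite eq_le !leNgt; apply/andP.
  by split; apply/negP => h; apply: nPhi; [exists 0, y|exists y, 0].
have [_] := primitive_derive (represents_integrable fi rv) (profile_continuous rv (x := x)).
rewrite PE derive_cst => /esym/eqP; rewrite normr_eq0 => /eqP //.
Qed.

(** The representative [v] is zero, so [|dg - df|] bounds the variation of [|w|], and the norm bound
    for [g] is the claim. *)
Lemma maximal_deriv_continuous_at_zero (f df v : R -> R) (eps : R) : W11 f df -> represents v f df ->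
  ~ adm v -> 0 < eps -> exists2 delta : R, 0 < delta &
  forall g dg : R -> R, W11 g dg ->
    (W11_norm (g \- f)%R (dg \- df)%R < delta%:E)%E ->
    ('N[mu]_(q%:E)[EFin \o (fun x => `|frac_maximal_deriv beta g x| -
                                    `|frac_maximal_deriv beta f x|)%R] < eps%:E)%E.
Proof.
move=> Wf rv nadm eps0; have [fi dfi] := W11i Wf.
have C0 : 0 <= C by rewrite mulr_ge0 ?powR_ge0.
have C1 : 0 < C + 1 by rewrite ltr_wpDl.
exists (eps / (C + 1)); first by rewrite divr_gt0.
move=> g dg Wg We; have [gi dgi] := W11i Wg; have [w rw] := W11_represents Wg.
have [_ dI] := W11_norm_le (ltW We).
have rB := representsB dfi dgi rv rw.
have idB : mu.-integrable setT (EFin \o (dg \- df)%R).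
  exact: (@integrableB _ _ _ mu setT measurableT _ _ dgi dfi).
have vb := represents_var_bound idB rB.
have wE : (fun x => `|w x - v x|) = (fun x => `|w x|).
  by apply/funext => x; rewrite (profile_zero Wf rv nadm) subr0.
rewrite wE in vb.
have DE : (\int[mu]_t `|(dg \- df)%R t|%:E = (fine (\int[mu]_t `|(dg \- df)%R t|%:E))%:E)%E.
  by rewrite fineK//; apply: integrable_fin_num => //; exact: integrable_norm.
have := maximal_deriv_norm beta_gt0 beta_lt1 Wg rw vb DE.
set D := fine _ in DE *.
have [_ ->] := maximal_deriv_zero beta_gt0 Wf rv nadm.
have -> : ('N[mu]_(q%:E)[EFin \o (fun x => `|frac_maximal_deriv beta g x| - `|@cst R R 0 x|)%R] =
    'N[mu]_(q%:E)[EFin \o frac_maximal_deriv beta g])%E.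
  by rewrite unlock; congr (_ `^ _)%E; apply: eq_integral => x _; rewrite /= normr0 subr0 normr_id.
move=> /le_lt_trans; apply; rewrite lte_fin.
have De : D <= eps / (C + 1) by rewrite -lee_fin -DE.
apply: (@le_lt_trans _ _ (C * (eps / (C + 1)))); first by rewrite ler_wpM2l.
by rewrite mulrCA gtr_pMr// ltr_pdivrMr// mul1r ltrDl.
Qed.

(** Small Sobolev distance makes the profiles close, and [wdiff_dx_stable] at the limit function
    does the rest; only the exceptional set of the limit enters. *)
Lemma maximal_dx_cvg (f df v : R -> R) (x : R) (gs dgs ws : nat -> R -> R) (e : R) :
  W11 f df -> represents v f df -> adm v ->
  ~ exceptional beta (fun t => `|v t|) (primitive (fun t => `|v t|)) x -> 0 < e ->
  (forall n, [/\ W11 (gs n) (dgs n), represents (ws n) (gs n) (dgs n), adm (ws n) &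
    (W11_norm (gs n \- f)%R (dgs n \- df)%R <= (e / n.+1%:R)%:E)%E]) ->
  maximal_dx beta (ws n) x @[n --> \oo] --> maximal_dx beta v x.
Proof.
move=> Wf rv av nx e0 H; have [fi dfi] := W11i Wf.
apply/cvgrPdist_le => eta eta0.
have := wdiff_dx_stable beta_gt0 beta_lt1 av nx (radius_maximizer beta_gt0 beta_lt1 x av) eta0.
rewrite near_withinE => /nbhs_ballP[e1 /= e10 He].
near=> n.
have [Wg rw aw We] := H n; have [gi dgi] := W11i Wg.
have en0 : 0 < e / n.+1%:R by rewrite divr_gt0.
rewrite distrC; apply: (He _ _ en0 _ _ x x _ aw) => //.
- rewrite /ball/= sub0r normrN gtr0_norm// ltr_pdivrMr// -ltr_pdivrMl// mulrC.
  rewrite (@lt_le_trans _ _ n%:R) ?ler_nat//.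
  by near: n; exact: nbhs_infty_gtr.
- exact: (profile_close fi dfi gi dgi rv rw We).
- by rewrite subrr normr0 ltW.
- by rewrite subrr normr0 ltW.
- exact: (radius_maximizer beta_gt0 beta_lt1 x aw).
Unshelve. all: by end_near. Qed.

(** On a bounded set the maximizing radii of all nearby functions stay above [r0], so the slope is
    at most [r0 ^ (beta - 1) / 2] times a bound for the profile. *)
Lemma maximal_dx_locally_bounded (f df v : R -> R) (A : R) : W11 f df -> represents v f df ->
  adm v -> 0 <= A -> exists e M, [/\ 0 < e, 0 <= M &
    forall g dg w, W11 g dg -> represents w g dg ->
      (W11_norm (g \- f)%R (dg \- df)%R <= e%:E)%E ->
      adm w /\ forall x, `|x| <= A -> `|maximal_dx beta w x| <= M].
Proof.
move=> Wf rv av A0; have [fi dfi] := W11i Wf.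
have [r0 [R0 [e1 [s0 [[r00 e10 s00 _ _] H]]]]] := wdiff_concentrated beta_gt0 beta_lt1 av A0.
have [a [b ab]] := adm_neq0 av; have [Mv vM] := adm_bound av.
have Mv0 : 0 <= Mv by rewrite (le_trans _ (vM 0)).
(* A quarter of the increment, so that half of it survives for [w] and [w] is again admissible. *)
pose e2 := (primitive (fun t => `|v t|) b - primitive (fun t => `|v t|) a) / 4.
have e20 : 0 < e2 by rewrite divr_gt0// subr_gt0.
exists (Num.min 1 (Num.min e1 e2)), (r0 `^ (beta - 1) / 2 * (Mv + 1)); split.
- by rewrite !lt_min ltr01 e10.
- by rewrite mulr_ge0 ?divr_ge0 ?powR_ge0 ?addr_ge0.
move=> g dg w Wg rw We; have [gi dgi] := W11i Wg.
have cl := profile_close fi dfi gi dgi rv rw We.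
have cl' t : [/\ `| `|v t| - `|w t| | <= 1, `| `|v t| - `|w t| | <= e1,
    `|primitive (fun t => `|v t|) t - primitive (fun t => `|w t|) t| <= e1 &
    `|primitive (fun t => `|v t|) t - primitive (fun t => `|w t|) t| <= e2].
  have [] := cl t; rewrite !le_min => /and3P[? ? ?] /and3P[? ? ?]; by split.
have aw : adm w.
  apply: (profile_admissible gi dgi rw); exists a, b.
  have [_ _ _ /ler_normlP[a1 a2]] := cl' a; have [_ _ _ /ler_normlP[b1 b2]] := cl' b.
  move: a1 a2 b1 b2; rewrite /e2; move: ab; lra.
split => // x xA.
have mx := radius_maximizer beta_gt0 beta_lt1 x aw; have [r_gt0 mr] := mx.
have r0r : r0 <= radius beta (primitive (fun t => `|w t|)) x.
  rewrite leNgt; apply/negP => h; have := mr _ s00; apply/negP; rewrite -ltNge.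
  apply: (H _ _ x _ aw) => //; last by rewrite h.
  by move=> t; have [_ h1 h2 _] := cl' t; split.
have wM t : `|w t| <= Mv + 1.
  by have [/ler_normlP[h1 h2] _ _ _] := cl' t; have := vM t; lra.
rewrite /maximal_dx /wdiff normrM ger0_norm ?divr_ge0 ?powR_ge0//.
set r := radius _ _ _ in r_gt0 r0r *.
apply: ler_pM; rewrite ?divr_ge0 ?powR_ge0 ?normr_ge0//.
  rewrite ler_wpM2r// -(opprB 1 beta) !powRN lef_pV2 ?posrE ?powR_gt0//.
  by apply: ge0_ler_powR; rewrite ?nnegrE ?subr_ge0 ?(ltW beta_lt1) ?(ltW r00) ?(ltW r_gt0).
have := wM (x + r); have := wM (x - r); have := normr_ge0 (w (x + r)); have := normr_ge0 (w (x - r)).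
by move=> *; apply/ler_normlP; split; lra.
Qed.

Lemma dist_powR_le (a b : R) : 0 <= a -> 0 <= b -> `|a - b| `^ q <= a `^ q + b `^ q.
Proof.
move=> a0 b0; have q0 := ltW q_gt0.
have [ab|/ltW ba] := lerP a b.
  apply: (@le_trans _ _ (b `^ q)); last by rewrite lerDr powR_ge0.
  by apply: ge0_ler_powR; rewrite ?nnegrE ?subr_ge0//; lra.
apply: (@le_trans _ _ (a `^ q)); last by rewrite lerDl powR_ge0.
by apply: ge0_ler_powR; rewrite ?nnegrE ?subr_ge0//; lra.
Qed.

Let H v w x := `| `|maximal_dx beta w x| - `|maximal_dx beta v x| | `^ q.

Let measurable_H v w (D : set R) : adm v -> adm w -> measurable_fun D (EFin \o H v w).
Proof.
move=> av aw; apply/measurable_EFinP; apply: measurable_powR_comp; apply: measurableT_comp => //.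
apply: measurable_funB; apply: measurableT_comp => //.
  exact: measurable_funS (measurable_maximal_dx beta_gt0 beta_lt1 aw).
exact: measurable_funS (measurable_maximal_dx beta_gt0 beta_lt1 av).
Qed.

Lemma maximal_deriv_dist (f df v g dg w : R -> R) : W11 f df -> represents v f df -> adm v ->
  W11 g dg -> represents w g dg -> adm w ->
  ('N[mu]_(q%:E)[EFin \o (fun x => `|frac_maximal_deriv beta g x| -
                                  `|frac_maximal_deriv beta f x|)%R] =
   (\int[mu]_x (H v w x)%:E) `^ q^-1)%E.
Proof.
move=> Wf rv av Wg rw aw; rewrite unlock; congr (_ `^ _)%E.
have [N1 [c1 _ /(_ av) H1]] := maximal_deriv_ae beta_gt0 beta_lt1 Wf rv.
have [N2 [c2 _ /(_ aw) H2]] := maximal_deriv_ae beta_gt0 beta_lt1 Wg rw.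
apply: ge0_ae_eq_integral => //.
- apply/measurable_EFinP; apply: measurable_powR_comp; apply: measurableT_comp => //.
  apply: measurable_funB; apply: measurableT_comp => //.
    exact: measurable_maximal_deriv Wg rw.
  exact: measurable_maximal_deriv Wf rv.
- exact: measurable_H.
- by move=> x _; rewrite lee_fin powR_ge0.
- by move=> x _; rewrite lee_fin powR_ge0.
- have E1 : {ae mu, forall x, frac_maximal_deriv beta f x = maximal_dx beta v x}.
    exact: (ae_off_countable c1 H1).
  have E2 : {ae mu, forall x, frac_maximal_deriv beta g x = maximal_dx beta w x}.
    exact: (ae_off_countable c2 H2).
  apply: filterS2 E1 E2; first exact: (ae_filter_ringOfSetsType mu).
  by move=> x /= -> -> _.
Qed.

(** By contradiction, because dominated convergence is sequential: a sequence of counterexamples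
    approaching [f] is shown to satisfy the estimate for some index. *)
Lemma maximal_deriv_continuous_at (f df v : R -> R) (eps : R) : W11 f df -> represents v f df ->
  adm v -> 0 < eps -> exists2 delta : R, 0 < delta &
  forall g dg : R -> R, W11 g dg ->
    (W11_norm (g \- f)%R (dg \- df)%R < delta%:E)%E ->
    ('N[mu]_(q%:E)[EFin \o (fun x => `|frac_maximal_deriv beta g x| -
                                    `|frac_maximal_deriv beta f x|)%R] < eps%:E)%E.
Proof.
move=> Wf rv av eps0.
(* The budget [eps ^ q] is spent as [k / 4] on [[- A, A]] and [k / 4] for the tail of each of the
   two functions, in total less than [k]. *)
pose k := eps `^ q; have k0 : 0 < k by exact: powR_gt0.
have k40 : 0 < k / 4 by rewrite divr_gt0.
have [A [e1 [A0 e10 Htail]]] := maximal_tail_small Wf rv k40.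
have [e2 [M [e20 M0 Hbnd]]] := maximal_dx_locally_bounded Wf rv av (ltW A0).
pose e := Num.min e1 e2; have e0 : 0 < e by rewrite lt_min e10.
apply: contrapT => nex.
have step n : exists p : (R -> R) * (R -> R) * (R -> R),
    [/\ W11 p.1.1 p.1.2, represents p.2 p.1.1 p.1.2,
     (W11_norm (p.1.1 \- f)%R (p.1.2 \- df)%R <= (e / n.+1%:R)%:E)%E &
     (eps%:E <= 'N[mu]_(q%:E)[EFin \o (fun x => `|frac_maximal_deriv beta p.1.1 x| -
                                    `|frac_maximal_deriv beta f x|)%R])%E].
  apply: contrapT => nstep; apply: nex; exists (e / n.+1%:R); first by rewrite divr_gt0.
  move=> g dg Wg We; rewrite ltNge; apply/negP => h; apply: nstep.
  by have [w rw] := W11_represents Wg; exists (g, dg, w); split => //=; exact: ltW.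
have [p Hp] := choice step.
pose gs n := (p n).1.1; pose dgs n := (p n).1.2; pose ws n := (p n).2.
have en n : e / n.+1%:R <= e1 /\ e / n.+1%:R <= e2.
  have h : e / n.+1%:R <= e by rewrite ler_pdivrMr// ler_peMr ?ler1n// ltW.
  by split; apply: (le_trans h); rewrite ge_min lexx ?orbT.
have Hn n : [/\ W11 (gs n) (dgs n), represents (ws n) (gs n) (dgs n), adm (ws n) &
    (W11_norm (gs n \- f)%R (dgs n \- df)%R <= (e / n.+1%:R)%:E)%E].
  have [Wg rw We _] := Hp n; split => //.
  by have [] := Hbnd _ _ _ Wg rw (le_trans We _); rewrite ?lee_fin; have [] := en n.
(* [f] counts as its own perturbation, so the tail and local bounds hold for [v] as well. *)
have n00 e' : 0 <= e' -> (W11_norm (f \- f)%R (df \- df)%R <= e'%:E)%E.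
  move=> e'0; rewrite /W11_norm !Lnorm1.
  by rewrite !integral0_eq ?add0e ?lee_fin// => x _; rewrite /= subrr normr0.
have We0 := n00 _ (ltW e20); have We1 := n00 _ (ltW e10).
have mI : measurable (`[- A, A] : set R) by exact: measurable_itv.
have muI : (mu (`[(- A)%R, A]%classic : set R) < +oo)%E.
  by rewrite lebesgue_measure_itv/=; case: ifP => _; rewrite -?EFinB ltry.
have mS : measurable [set x : R | A < `|x|] by exact: measurable_set_lt.
have H0 n x : (0 <= (H v (ws n) x)%:E)%E by rewrite lee_fin powR_ge0.
have mH n D : measurable_fun D (EFin \o H v (ws n)).
  by have [_ _ aw _] := Hn n; exact: measurable_H.
have cvI : (\int[mu]_(x in `[(- A)%R, A]) (H v (ws n) x)%:E)%E @[n --> \oo] --> 0%E.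
  have [] := @dominated_convergence _ _ _ mu (`[- A, A]) mI
    (fun n x => (H v (ws n) x)%:E) (cst 0%E) (cst (M `^ q + M `^ q)%:E).
  - by move=> n; exact: mH.
  - exact: measurable_cst.
  - apply: (ae_off_countable (countable_exceptional beta_gt0 beta_lt1 av)) => x nx _.
    apply: cvg_EFin; first by near=> n.
    have := maximal_dx_cvg Wf rv av nx e0 Hn => cv.
    have q0 : q != 0 by rewrite gt_eqF.
    apply/cvgrPdist_lt => eta eta0.
    have s0 : 0 < eta `^ q^-1 by rewrite powR_gt0.
    have /cvgrPdist_lt/(_ _ s0) cv' := cv.
    near=> n; rewrite sub0r normrN ger0_norm ?powR_ge0//.
    apply: powR_lt_root => //; first exact: ltW.
    by apply: (le_lt_trans (ler_dist_dist _ _)); rewrite distrC; near: n.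
  - apply/integrableP; split; first exact: measurable_cst.
    rewrite (_ : (fun x => `|cst (M `^ q + M `^ q)%:E x|%E) = cst `|(M `^ q + M `^ q)%:E|%E)//.
    by rewrite integral_cst//; exact: lte_mul_pinfty.
  - apply: aeW => x n xI; rewrite gee0_abs// lee_fin.
    apply: (le_trans (dist_powR_le _ _)) => //.
    have xA : `|x| <= A by move: xI; rewrite /= in_itv/= ler_norml.
    have [Wg rw aw We] := Hn n.
    have We2 : (W11_norm (gs n \- f)%R (dgs n \- df)%R <= e2%:E)%E.
      by apply: (le_trans We); rewrite lee_fin; have [] := en n.
    have [_ Bw] := Hbnd _ _ _ Wg rw We2.
    have [_ Bv] := Hbnd _ _ _ Wf rv We0.
    by apply: lerD; apply: ge0_ler_powR; rewrite ?nnegrE ?(ltW q_gt0)//; [exact: Bw|exact: Bv].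
  by rewrite integral_cst// mul0e.
have [n In] : exists n, (\int[mu]_(x in `[(- A)%R, A]) (H v (ws n) x)%:E <= (k / 4)%:E)%E.
  have /fine_cvgP[fin /cvgrPdist_lt/(_ _ k40) cv] := cvI.
  have [n _ /(_ n (leqnn n)) [fn cn]] : \forall n \near \oo,
      (\int[mu]_(x in `[(- A)%R, A]) (H v (ws n) x)%:E)%E \is a fin_num /\
      `|0 - fine (\int[mu]_(x in `[(- A)%R, A]) (H v (ws n) x)%:E)%E| < k / 4.
    exact: filterS2 fin cv.
  exists n; rewrite -(fineK fn) lee_fin ltW//; move: cn; rewrite sub0r normrN.
  by apply: le_lt_trans; exact: ler_norm.
have [Wg rw aw We] := Hn n.
have mdx w' (S : set R) : adm w' ->
    measurable_fun S (fun x => (`|maximal_dx beta w' x| `^ q)%:E).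
  move=> aw'; apply/measurable_EFinP; apply: measurable_powR_comp; apply: measurableT_comp => //.
  exact: measurable_funS (measurable_maximal_dx beta_gt0 beta_lt1 aw').
have Tn : (\int[mu]_(x in [set x : R | (A < `|x|)%R]) (H v (ws n) x)%:E <= (k / 4 + k / 4)%:E)%E.
  apply: (@le_trans _ _ (\int[mu]_(x in [set x : R | (A < `|x|)%R])
    ((`|maximal_dx beta (ws n) x| `^ q)%:E + (`|maximal_dx beta v x| `^ q)%:E))%E).
    apply: ge0_le_integral => //.
    - exact: mH.
    - by apply: emeasurable_funD; exact: mdx.
    - by move=> x _; rewrite -EFinD lee_fin; exact: dist_powR_le.
  rewrite ge0_integralD//; try exact: mdx; try by move=> x _; rewrite lee_fin powR_ge0.
  rewrite EFinD; apply: leeD; last exact: Htail Wf rv av We1.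
  by apply: Htail Wg rw aw _; apply: (le_trans We); rewrite lee_fin; have [] := en n.
have Itot : (\int[mu]_x (H v (ws n) x)%:E <= (k / 4 + (k / 4 + k / 4))%:E)%E.
  have -> : [set: R] = `[- A, A] `|` [set x : R | A < `|x|].
    apply/seteqP; split => x //= _; rewrite in_itv/= -ler_norml.
    by have [|] := boolP (`|x| <= A); [left|rewrite -ltNge; right].
  rewrite ge0_integral_setU//.
  - by rewrite EFinD; exact: leeD.
  - exact: mH.
  - apply/disj_setPS => x [] /=; rewrite in_itv/= -ler_norml => h1 h2.
    by move: (lt_le_trans h2 h1); rewrite ltxx.
have [_ _ _] := Hp n; apply/negP; rewrite -ltNge (maximal_deriv_dist Wf rv av Wg rw aw).
have q0 : 0 <= q^-1 by rewrite invr_ge0 ltW.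
apply: (@le_lt_trans _ _ ((k / 4 + (k / 4 + k / 4))%:E `^ q^-1)%E).
  apply: gt0_ler_poweR => //.
  - by rewrite in_itv/= leey andbT integral_ge0.
  - by rewrite in_itv/= leey andbT lee_fin !addr_ge0// ltW.
have epsE : eps = k `^ q^-1 by rewrite -powRrM mulfV ?powRr1 ?lt0r_neq0// ltW.
rewrite poweR_EFin lte_fin epsE.
apply: gt0_ltr_powR; rewrite ?nnegrE ?invr_gt0 ?powR_ge0 ?addr_ge0 ?(ltW k40)// -/k; lra.
Unshelve. all: by end_near. Qed.

End continuity.

Theorem theorem1p1 (R : realType) (beta : R)
    (beta_gt0 : 0 < beta) (beta_lt1 : beta < 1) :
  let q : R := 1 / (1 - beta) in
  let C : R := 2 `^ (- 3 * beta - 2 + 4 / beta) *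
               3 `^ (2 * (1 - beta) ^+ 2 / beta) in
  let mu := @lebesgue_measure R in
  (forall f df : R -> R, W11 f df ->
     [/\ {ae mu, forall x, ediff_at (frac_maximal beta f) x},
         frac_maximal_deriv beta f \in Lfun mu q%:E &
         ('N[mu]_(q%:E)[EFin \o frac_maximal_deriv beta f] <=
            C%:E * 'N[mu]_1[EFin \o df])%E]) /\
  (forall f df : R -> R, W11 f df ->
     forall eps : R, 0 < eps -> exists2 delta : R, 0 < delta &
       forall g dg : R -> R, W11 g dg ->
         (W11_norm (g \- f)%R (dg \- df)%R < delta%:E)%E ->
         ('N[mu]_(q%:E)[EFin \o (fun x => `|frac_maximal_deriv beta g x| -
                                         `|frac_maximal_deriv beta f x|)%R] <
            eps%:E)%E).
Proof.
move=> q C mu; split=> [f df|f df Wf eps eps0]; first exact: maximal_deriv_bound.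
have [v rv] := W11_represents Wf.
have [av|nav] := pselect (admissible (fun t => `|v t|) (primitive (fun t => `|v t|))).
  exact: (maximal_deriv_continuous_at beta_gt0 beta_lt1 Wf rv av eps0).
exact: (maximal_deriv_continuous_at_zero beta_gt0 beta_lt1 Wf rv nav eps0).
Qed.
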